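(* (Noncommutative Cardano formula.) Let $f=x^3A+3x^2yB+3xy^2C+y^3D$ be a cubic form with $A,B,C,D\in H_{I\setminus\{0,1\}}$, let $d_3$ be its discriminant, let $\Delta$ and $j$ be its Hessian and cubic covariants, and put $f_1=P_{01}^3f$, $\Delta_1=P_{01}^2\Delta$, $j_1=P_{01}^3j$, $\xi=P_{01}^2f=x\delta-y\gamma-hy\delta$ (with $\gamma,\delta\in H_{I\setminus\{0\}}$), $\eta=(01)$, $\varepsilon=e^{2\pi i/3}$. Then $$f\,f_1^2=\xi^3+3\Delta_1\eta^2\xi-j_1\eta^3 .$$ In the central skew field extension of $Q_I$ obtained by adjoining (central, commuting) elements $\sqrt{-d_3}$ and $$u_{1}=\sqrt[3]{\tfrac12\left(j_1+f_1\sqrt{-d_3}\right)},\qquad u_{2}=\sqrt[3]{\tfrac12\left(j_1-f_1\sqrt{-d_3}\right)},\qquad u_1u_2=-\Delta_1,$$ the form $f$ decomposes into three linear forms $$f=C_0\,\bigl(\xi-(u_1+u_2)\eta\bigr)\bigl(\xi-(\varepsilon u_1+\varepsilon^2u_2)\eta\bigr)\bigl(\xi-(\varepsilon^2u_1+\varepsilon u_2)\eta\bigr)$$ with some $C_0\in Q^{Inv}_{I\setminus\{0\}}$, where for $\nu=1,2,3$ $$\xi-(\varepsilon^\nu u_1+\varepsilon^{2\nu}u_2)\eta=xY_\nu-yX_\nu-hyY_\nu,\quad X_\nu=\gamma-(\varepsilon^\nu u_1+\varepsilon^{2\nu}u_2)x_1,\quad Y_\nu=\delta-(\varepsilon^\nu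 u_1+\varepsilon^{2\nu}u_2)y_1 .$$ Here $\gamma,\delta$ have the explicit form $$\gamma=-x_1^2(B+hA)-x_1y_1(2C+3hB+h^2A)-y_1^2(D+2hC+h^2B-h^3A),$$ $$\delta=x_1^2A+x_1y_1(2B-hA)+y_1^2(C-hB+h^2A).$$ The corresponding projective coordinates $Z_\nu=X_\nu Y_\nu^{-1}+\frac h2$ are $$Z_\nu=\bigl(\gamma-(\varepsilon^\nu u_1+\varepsilon^{2\nu}u_2)x_1\bigr)\bigl(\delta-(\varepsilon^\nu u_1+\varepsilon^{2\nu}u_2)y_1\bigr)^{-1}+\tfrac h2 .$$
   Context: Fix $h\in\mathbb C$, $h\neq0$. $U_h(sl(2))$ is the complex unital Hopf algebra with generators $E,F,H$, relations $[H,E]=E\cosh(hF)+\cosh(hF)E$, $[H,F]=-\frac2h\sinh(hF)$, $[E,F]=H$, and coproduct $\Delta(E)=E\otimes e^{-hF}+e^{hF}\otimes E$, $\Delta(F)=F\otimes1+1\otimes F$, $\Delta(H)=H\otimes e^{-hF}+e^{hF}\otimes H$. For a totally ordered index set $I$, $H_I$ is the unital complex algebra with generators $x_i,y_i$ ($i\in I$) and relations $x_iy_i=y_ix_i+hy_i^2$ and, for $i<j$, $x_jy_i=y_ix_j+hy_iy_j$, $y_jx_i=x_iy_j-hy_iy_j$, $y_jy_i=y_iy_j$, $x_jx_i=x_ix_j-hx_iy_j+hy_ix_j+h^2y_iy_j$. It is a $U_h(sl(2))$-module algebra via $Hx_i=x_i$, $Hy_i=-y_i$, $Ex_i=0$,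 $Ey_i=x_i$, $Fx_i=y_i$, $Fy_i=0$, $E1=F1=H1=0$ and the Leibniz rules given by the coproduct. $H_I$ is a domain with right quotient division ring $Q_I$, to which the action extends. Invariant elements $v$ are those with $Ev=Fv=Hv=0$ (superscript $Inv$). $(ij)=x_iy_j-y_ix_j-hy_iy_j$. Assume $0,1\in I$, $x=x_0$, $y=y_0$. $H_J$, $Q_J$ are the subalgebras belonging to $J\subseteq I$. An $n$-form is a nonzero element $f=\sum_i\binom nix^{n-i}y^iA_i\in H_I^{Inv}$ with $A_i\in H_{I\setminus\{0\}}$ (the $A_i$ are unique); a cubic form is a $3$-form, a linear form a $1$-form. Polarization: $\Delta_{kl}$ is the derivation of $H_I$ with $x_k\mapsto x_l$, $y_k\mapsto y_l$ and all other generators $\mapsto0$; $P_{kl}a=\frac1m\Delta_{kl}(a)$ if $a$ is homogeneous of degree $m$ in the index $k$. For an $n$-form $f$ with coefficients in $H_{I\setminus\{0,1\}}$, $P_{01}^nf$ is obtained by replacing $x,y$ by $x_1,y_1$ in $f=\sum\binom nix^{n-i}y^iA_i$. Covariants of the cubic form: let $K=2AC-2B^2-4hAB+2h^2A^2$, $L=2AD-2BC-2hAC+4h^2AB-2h^3A^2$, $M=2BD-2C^2-4hAD+6h^2B^2-6h^3AB+8h^4A^2$. The Hessian covariant is $\Delta=\frac12(x^2K+xyL+y^2M)\in H_I^{Inv}$. The discriminant $d_3$ is defined by $2d_3=2KM-\frac12L^2-hKL+\frac{3h^2}2K^2$. The cubic covariant $j$ is the (unique) element of $H_I^{Inv}$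 of the form $j=x^3S+x^2yS_1+xy^2S_2+y^3S_3$ with $S_1,S_2,S_3$ polynomial expressions in $A,B,C,D$ and $S=A^2D-3ABC+2B^3+9hAB^2-2h^2A^2B+6h^3A^3$. With these normalizations $4\Delta^3+j^2+d_3f^2=0$.
   Formalization: The displayed formula for γ contradicts ξ = xδ − yγ − hyδ (it would force δ = 0, e.g. it fails for f = (02)(03)(04)); the theorem takes γ to be the displayed expression minus hδ, keeping δ, ξ, X_ν, Y_ν and Z_ν as stated. *)

(* Defs.v *)
From HB Require Import structures.
From mathcomp Require Import all_boot all_order all_algebra.
From mathcomp Require Import boolp classical_sets reals trigo.
From mathcomp Require Import complex.

Set Implicit Arguments.
Unset Strict Implicit.
Unset Printing Implicit Defensive.

Import Order.TTheory GRing.Theory Num.Theory.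
Local Open Scope ring_scope.
Local Open Scope quotient_scope.

(** [HI h I] is the unital K-algebra with generators x_i, y_i (i in I) and the
    relations of [HI_relations]: formal expressions in the generators modulo
    the congruence generated by the axioms of unital K-algebras and by those
    relations. Its universal property is [HI_universal]. *)

Record HI_relations (K : fieldType) (disp : Order.disp_t) (I : orderType disp)
    (h : K) (A : algType K) (x y : I -> A) : Prop := {
  HI_rel_self : forall i, x i * y i = y i * x i + h *: (y i * y i);
  HI_rel_xy : forall i j, (i < j)%O -> x j * y i = y i * x j + h *: (y i * y j);
  HI_rel_yx : forall i j, (i < j)%O -> y j * x i = x i * y j - h *: (y i * y j);
  HI_rel_yy : forall i j, (i < j)%O -> y j * y i = y i * y j;
  HI_rel_xx : forall i j, (i < j)%O ->
    x j * x i = x i * x j - h *: (x i * y j) + h *: (y i * x j)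
                + h ^+ 2 *: (y i * y j)
}.

Section Presentation.
Variables (K : fieldType) (disp : Order.disp_t) (I : orderType disp) (h : K).

Inductive hterm : Type :=
| TX of I
| TY of I
| TC of K
| TAdd of hterm & hterm
| TMul of hterm & hterm.

Local Notation "s +' t" := (TAdd s t) (at level 50, left associativity).
Local Notation "s *' t" := (TMul s t) (at level 40, left associativity).
Local Notation "c *:' t" := (TMul (TC c) t) (at level 40).

Inductive hcongr : hterm -> hterm -> Prop :=
| hc_refl t : hcongr t t
| hc_sym s t : hcongr s t -> hcongr t s
| hc_trans s t u : hcongr s t -> hcongr t u -> hcongr s u
| hc_add s s' t t' : hcongr s s' -> hcongr t t' -> hcongr (s +' t) (s' +' t')
| hc_mul s s' t t' : hcongr s s' -> hcongr t t' -> hcongr (s *' t) (s' *' t')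
| hc_addA s t u : hcongr (s +' (t +' u)) (s +' t +' u)
| hc_addC s t : hcongr (s +' t) (t +' s)
| hc_add0 t : hcongr (TC 0 +' t) t
| hc_addN t : hcongr (((-1) *:' t) +' t) (TC 0)
| hc_mulA s t u : hcongr (s *' (t *' u)) (s *' t *' u)
| hc_mul1 t : hcongr (TC 1 *' t) t
| hc_mulDl s t u : hcongr ((s +' t) *' u) (s *' u +' t *' u)
| hc_mulDr s t u : hcongr (s *' (t +' u)) (s *' t +' s *' u)
| hc_cstD a b : hcongr (TC (a + b)) (TC a +' TC b)
| hc_cstM a b : hcongr (TC (a * b)) (TC a *' TC b)
| hc_cstC a t : hcongr (TC a *' t) (t *' TC a)
| hc_self i : hcongr (TX i *' TY i) (TY i *' TX i +' h *:' (TY i *' TY i))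
| hc_xy i j : (i < j)%O ->
    hcongr (TX j *' TY i) (TY i *' TX j +' h *:' (TY i *' TY j))
| hc_yx i j : (i < j)%O ->
    hcongr (TY j *' TX i) (TX i *' TY j +' (- h) *:' (TY i *' TY j))
| hc_yy i j : (i < j)%O -> hcongr (TY j *' TY i) (TY i *' TY j)
| hc_xx i j : (i < j)%O ->
    hcongr (TX j *' TX i)
      (TX i *' TX j +' (- h) *:' (TX i *' TY j) +' h *:' (TY i *' TX j)
       +' (h ^+ 2) *:' (TY i *' TY j)).

Fixpoint heval (A : algType K) (x y : I -> A) (t : hterm) : A :=
  match t with
  | TX i => x i
  | TY i => y i
  | TC c => c%:A
  | TAdd s t => heval x y s + heval x y t
  | TMul s t => heval x y s * heval x y t
  end.

Lemma heval_congr (A : algType K) (x y : I -> A) :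
  HI_relations h x y -> forall s t, hcongr s t -> heval x y s = heval x y t.
Proof.
move=> [Hself Hxy Hyx Hyy Hxx] s t; elim=> /=.
- by [].
- by [].
- by move=> ? ? ? _ -> _ ->.
- by move=> ? ? ? ? _ -> _ ->.
- by move=> ? ? ? ? _ -> _ ->.
- by move=> *; rewrite addrA.
- by move=> *; rewrite addrC.
- by move=> *; rewrite scale0r add0r.
- by move=> ?; rewrite -scalerAl mul1r scaleN1r addNr scale0r.
- by move=> *; rewrite mulrA.
- by move=> *; rewrite scale1r mul1r.
- by move=> *; rewrite mulrDl.
- by move=> *; rewrite mulrDr.
- by move=> *; rewrite scalerDl.
- by move=> *; rewrite -scalerAl mul1r scalerA.
- by move=> *; rewrite -scalerAl -scalerAr mul1r mulr1.
- by move=> i; rewrite Hself -scalerAl mul1r.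
- by move=> i j ij; rewrite Hxy // -scalerAl mul1r.
- by move=> i j ij; rewrite Hyx // -scalerAl mul1r scaleNr.
- by move=> i j ij; rewrite Hyy.
- by move=> i j ij; rewrite Hxx // -!scalerAl !mul1r scaleNr.
Qed.

HB.instance Definition _ := gen_eqMixin hterm.
HB.instance Definition _ := gen_choiceMixin hterm.

Definition hcongrb (s t : hterm) : bool := `[< hcongr s t >].

Lemma hcongrb_refl : reflexive hcongrb.
Proof. by move=> t; apply/asboolP/hc_refl. Qed.
Lemma hcongrb_sym : symmetric hcongrb.
Proof. by move=> s t; apply/asboolP/asboolP => /hc_sym. Qed.
Lemma hcongrb_trans : transitive hcongrb.
Proof.
by move=> t s u /asboolP st /asboolP tu; apply/asboolP; exact: hc_trans tu.
Qed.

Canonical hcongr_equiv := EquivRel hcongrb hcongrb_refl hcongrb_sym hcongrb_trans.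

Definition HI : Type := {eq_quot hcongrb}.

HB.instance Definition _ := Choice.on HI.
HB.instance Definition _ := Quotient.on HI.

Definition hpi (t : hterm) : HI := \pi_HI t.

Lemma hpiP s t : hcongr s t <-> hpi s = hpi t.
Proof.
split=> [st|/eqP]; first by apply/eqP; rewrite /hpi eqmodE; exact/asboolP.
by rewrite /hpi eqmodE => /asboolP.
Qed.

Lemma hpi_ind (P : HI -> Prop) : (forall t, P (hpi t)) -> forall a, P a.
Proof. by move=> Pt a; rewrite -[a]reprK; exact: Pt. Qed.

Fact hop_key : unit. Proof. by []. Qed.
Definition hadd : HI -> HI -> HI :=
  locked_with hop_key (fun a b => hpi (repr a +' repr b)).
Definition hmul : HI -> HI -> HI :=
  locked_with hop_key (fun a b => hpi (repr a *' repr b)).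
Definition hscale : K -> HI -> HI :=
  locked_with hop_key (fun c a => hpi (c *:' repr a)).

Lemma hcongr_repr t : hcongr (repr (hpi t)) t.
Proof. by apply/hpiP; rewrite /hpi reprK. Qed.

Lemma haddE s t : hadd (hpi s) (hpi t) = hpi (s +' t).
Proof.
by rewrite /hadd unlock; apply/hpiP/hc_add; exact: hcongr_repr.
Qed.
Lemma hmulE s t : hmul (hpi s) (hpi t) = hpi (s *' t).
Proof.
by rewrite /hmul unlock; apply/hpiP/hc_mul; exact: hcongr_repr.
Qed.
Lemma hscaleE c t : hscale c (hpi t) = hpi (c *:' t).
Proof.
rewrite /hscale unlock.
by apply/hpiP/hc_mul; [exact: hc_refl|exact: hcongr_repr].
Qed.

Fact haddA : associative hadd.
Proof.
elim/hpi_ind=> s; elim/hpi_ind=> t; elim/hpi_ind=> u.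
by rewrite !haddE; apply/hpiP/hc_addA.
Qed.
Fact haddC : commutative hadd.
Proof.
elim/hpi_ind=> s; elim/hpi_ind=> t; rewrite !haddE; exact/hpiP/hc_addC.
Qed.
Fact hadd0 : left_id (hpi (TC 0)) hadd.
Proof. by elim/hpi_ind=> t; rewrite haddE; apply/hpiP/hc_add0. Qed.
Fact haddN : left_inverse (hpi (TC 0)) (hscale (-1)) hadd.
Proof. by elim/hpi_ind=> t; rewrite hscaleE haddE; apply/hpiP/hc_addN. Qed.

HB.instance Definition _ :=
  GRing.isZmodule.Build HI haddA haddC hadd0 haddN.

Lemma hpiD s t : hpi s + hpi t = hpi (s +' t).
Proof. exact: haddE. Qed.

Fact hmulA : associative hmul.
Proof.
elim/hpi_ind=> s; elim/hpi_ind=> t; elim/hpi_ind=> u.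
by rewrite !hmulE; apply/hpiP/hc_mulA.
Qed.
Fact hmul1 : left_id (hpi (TC 1)) hmul.
Proof. by elim/hpi_ind=> t; rewrite hmulE; apply/hpiP/hc_mul1. Qed.
Fact hmulr1 : right_id (hpi (TC 1)) hmul.
Proof.
elim/hpi_ind=> t; rewrite hmulE; apply/hpiP.
by apply: hc_trans (hc_mul1 t); exact/hc_sym/hc_cstC.
Qed.
Fact hmulDl : left_distributive hmul hadd.
Proof.
elim/hpi_ind=> s; elim/hpi_ind=> t; elim/hpi_ind=> u.
by rewrite haddE !hmulE haddE; apply/hpiP/hc_mulDl.
Qed.
Fact hmulDr : right_distributive hmul hadd.
Proof.
elim/hpi_ind=> s; elim/hpi_ind=> t; elim/hpi_ind=> u.
by rewrite haddE !hmulE haddE; apply/hpiP/hc_mulDr.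
Qed.
Fact hone_neq0 : hpi (TC 1) != hpi (TC 0).
Proof.
have rel0 : HI_relations h (fun _ : I => 0 : K^o) (fun _ : I => 0 : K^o).
  by split=> *; rewrite ?(mulr0, scaler0, addr0, subr0).
apply/eqP=> /hpiP /(heval_congr rel0) /=.
by rewrite scale1r scale0r => /eqP; rewrite oner_eq0.
Qed.

HB.instance Definition _ :=
  GRing.Zmodule_isNzRing.Build HI hmulA hmul1 hmulr1 hmulDl hmulDr hone_neq0.

Lemma hpiM s t : hpi s * hpi t = hpi (s *' t).
Proof. exact: hmulE. Qed.

Fact hscaleA a b (u : HI) : hscale a (hscale b u) = hscale (a * b) u.
Proof.
elim/hpi_ind: u => t; rewrite !hscaleE; apply/hpiP.
apply: hc_trans (hc_mulA _ _ _) _; apply: hc_mul (hc_refl _).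
exact/hc_sym/hc_cstM.
Qed.
Fact hscale1 : left_id 1 hscale.
Proof. by elim/hpi_ind=> t; rewrite hscaleE; apply/hpiP/hc_mul1. Qed.
Fact hscaleDr : right_distributive hscale +%R.
Proof.
move=> c; elim/hpi_ind=> s; elim/hpi_ind=> t.
by rewrite hpiD !hscaleE hpiD; apply/hpiP/hc_mulDr.
Qed.
Fact hscaleDl (u : HI) : {morph hscale^~ u : a b / a + b}.
Proof.
elim/hpi_ind: u => t a b; rewrite /= !hscaleE hpiD; apply/hpiP.
by apply: hc_trans (hc_mulDl _ _ _); apply: hc_mul (hc_refl _); exact: hc_cstD.
Qed.

HB.instance Definition _ :=
  GRing.Zmodule_isLmodule.Build K HI hscaleA hscale1 hscaleDr hscaleDl.

Lemma hpiZ c t : c *: hpi t = hpi (c *:' t).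
Proof. exact: hscaleE. Qed.

Fact hscaleAl (c : K) (u v : HI) : c *: (u * v) = (c *: u) * v.
Proof.
elim/hpi_ind: u => s; elim/hpi_ind: v => t.
by rewrite !(hpiM, hpiZ); apply/hpiP/hc_mulA.
Qed.
HB.instance Definition _ := GRing.Lmodule_isLalgebra.Build K HI hscaleAl.

Fact hscaleAr (c : K) (u v : HI) : c *: (u * v) = u * (c *: v).
Proof.
elim/hpi_ind: u => s; elim/hpi_ind: v => t.
rewrite !(hpiM, hpiZ); apply/hpiP; apply: hc_trans (hc_mulA _ _ _) _.
apply: hc_trans (hc_sym (hc_mulA _ _ _)).
exact: hc_mul (hc_cstC _ _) (hc_refl _).
Qed.
HB.instance Definition _ := GRing.Lalgebra_isAlgebra.Build K HI hscaleAr.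

Definition gx (i : I) : HI := hpi (TX i).
Definition gy (i : I) : HI := hpi (TY i).

Lemma gxyP : HI_relations h gx gy.
Proof.
split=> [i|i j ij|i j ij|i j ij|i j ij]; rewrite /gx /gy -?scaleNr
  !(hpiM, hpiZ, hpiD); apply/hpiP.
- exact: hc_self.
- exact: hc_xy.
- exact: hc_yx.
- exact: hc_yy.
- exact: hc_xx.
Qed.

Lemma HI_universal (A : algType K) (x y : I -> A) : HI_relations h x y ->
  exists phi : {lrmorphism HI -> A},
    [/\ forall i, phi (gx i) = x i, forall i, phi (gy i) = y i
      & forall psi : {lrmorphism HI -> A},
          (forall i, psi (gx i) = x i) -> (forall i, psi (gy i) = y i) ->
          psi =1 phi].
Proof.
move=> rel; pose phi (a : HI) := heval x y (repr a).
have phiE t : phi (hpi t) = heval x y t.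
  exact/(heval_congr rel)/hcongr_repr.
have lin : linear phi.
  move=> c; elim/hpi_ind=> s; elim/hpi_ind=> t.
  by rewrite hpiZ hpiD !phiE /= -scalerAl mul1r.
have mon : monoid_morphism phi.
  split; first by rewrite [LHS]phiE /= scale1r.
  elim/hpi_ind=> s; elim/hpi_ind=> t.
  by rewrite hpiM !phiE.
pose l := GRing.isLinear.Build _ _ _ _ phi lin.
pose m := GRing.isMonoidMorphism.Build _ _ phi mon.
pose phiM : {lrmorphism HI -> A} := HB.pack phi l m.
exists phiM; split=> [i|i|psi psix psiy]; [exact: phiE|exact: phiE|].
elim/hpi_ind=> t; rewrite [RHS]phiE; elim: t => [i|i|c|s IHs t IHt|s IHs t IHt].
- exact: psix.
- exact: psiy.
- have -> : hpi (TC c) = c%:A.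
    rewrite hpiZ; apply/hpiP.
    by apply: hc_trans (hc_sym (hc_mul1 _)) (hc_cstC _ _).
  by rewrite linearZ rmorph1.
- by rewrite -hpiD rmorphD /= IHs IHt.
- by rewrite -hpiM rmorphM /= IHs IHt.
Qed.

End Presentation.

(** [opK] and [opKV] are the operators by which e^{hF} and e^{-hF} act.  On H_I
    the operator F is locally nilpotent and they are the exponential sums
    ([HI_action]); on the quotient division ring F is no longer locally
    nilpotent and they are the unique extensions ([action_extends]). *)

Record Uh_ops (V : Type) := UhOps {
  opE : V -> V;
  opF : V -> V;
  opH : V -> V;
  opK : V -> V;
  opKV : V -> V
}.

Record Uh_module_algebra (K : fieldType) (h : K) (A : algType K)
    (u : Uh_ops A) : Prop := {
  ma_linE : linear (opE u);
  ma_linF : linear (opF u);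
  ma_linH : linear (opH u);
  ma_linK : linear (opK u);
  ma_linKV : linear (opKV u);
  ma_KK : cancel (opK u) (opKV u);
  ma_KVK : cancel (opKV u) (opK u);
  (* [H, E] = E cosh(hF) + cosh(hF) E *)
  ma_HE : forall a,
    let coshF b := 2^-1 *: (opK u b + opKV u b) in
    opH u (opE u a) - opE u (opH u a) = opE u (coshF a) + coshF (opE u a);
  (* [H, F] = - (2 / h) sinh(hF) *)
  ma_HF : forall a,
    let sinhF b := 2^-1 *: (opK u b - opKV u b) in
    opH u (opF u a) - opF u (opH u a) = - (2 / h) *: sinhF a;
  ma_EF : forall a, opE u (opF u a) - opF u (opE u a) = opH u a;
  ma_E1 : opE u 1 = 0;
  ma_F1 : opF u 1 = 0;
  ma_H1 : opH u 1 = 0;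
  ma_K1 : opK u 1 = 1;
  ma_KV1 : opKV u 1 = 1;
  ma_EM : forall a b, opE u (a * b) = opE u a * opKV u b + opK u a * opE u b;
  ma_FM : forall a b, opF u (a * b) = opF u a * b + a * opF u b;
  ma_HM : forall a b, opH u (a * b) = opH u a * opKV u b + opK u a * opH u b;
  ma_KM : forall a b, opK u (a * b) = opK u a * opK u b;
  ma_KVM : forall a b, opKV u (a * b) = opKV u a * opKV u b
}.

Definition is_exponential (K : fieldType) (V : lmodType K) (c : K)
    (F G : V -> V) : Prop :=
  forall (n : nat) (a : V), iter n F a = 0 ->
    G a = \sum_(k < n) (c ^+ k / k`!%:R) *: iter k F a.

Record HI_action (K : fieldType) (disp : Order.disp_t) (I : orderType disp)
    (h : K) (u : Uh_ops (HI I h)) : Prop := {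
  ha_ma : Uh_module_algebra h u;
  ha_nilp : forall a, exists n, iter n (opF u) a = 0;
  ha_K : is_exponential h (opF u) (opK u);
  ha_KV : is_exponential (- h) (opF u) (opKV u);
  ha_Hx : forall i, opH u (gx h i) = gx h i;
  ha_Hy : forall i, opH u (gy h i) = - gy h i;
  ha_Ex : forall i, opE u (gx h i) = 0;
  ha_Ey : forall i, opE u (gy h i) = gx h i;
  ha_Fx : forall i, opF u (gx h i) = gy h i;
  ha_Fy : forall i, opF u (gy h i) = 0
}.

Record action_extends (K : fieldType) (h : K) (A B : algType K)
    (iota : A -> B) (u : Uh_ops A) (v : Uh_ops B) : Prop := {
  ext_ma : Uh_module_algebra h v;
  ext_E : forall a, opE v (iota a) = iota (opE u a);
  ext_F : forall a, opF v (iota a) = iota (opF u a);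
  ext_H : forall a, opH v (iota a) = iota (opH u a);
  ext_K : forall a, opK v (iota a) = iota (opK u a);
  ext_KV : forall a, opKV v (iota a) = iota (opKV u a)
}.

Definition is_invariant (A : zmodType) (u : Uh_ops A) (v : A) : Prop :=
  [/\ opE u v = 0, opF u v = 0 & opH u v = 0].

Inductive subalg_gen (K : fieldType) (A : algType K) (G : A -> Prop) :
    A -> Prop :=
| sg_gen a : G a -> subalg_gen G a
| sg_cst c : subalg_gen G c%:A
| sg_add a b : subalg_gen G a -> subalg_gen G b -> subalg_gen G (a + b)
| sg_mul a b : subalg_gen G a -> subalg_gen G b -> subalg_gen G (a * b).

Inductive divalg_gen (K : fieldType) (A : unitAlgType K) (G : A -> Prop) :
    A -> Prop :=
| dg_gen a : G a -> divalg_gen G a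
| dg_cst c : divalg_gen G c%:A
| dg_add a b : divalg_gen G a -> divalg_gen G b -> divalg_gen G (a + b)
| dg_mul a b : divalg_gen G a -> divalg_gen G b -> divalg_gen G (a * b)
| dg_inv a : divalg_gen G a -> divalg_gen G a^-1.

Definition division_ring (A : unitRingType) : Prop :=
  forall a : A, a != 0 -> a \is a GRing.unit.

Definition is_central (A : pzRingType) (a : A) : Prop := forall b, a * b = b * a.

Record right_quotient_division_ring (A : nzRingType) (Q : unitRingType)
    (iota : A -> Q) : Prop := {
  rq_inj : injective iota;
  rq_div : division_ring Q;
  rq_frac : forall q, exists a b, b != 0 /\ q = iota a / iota b
}.

(* H_J, as a predicate on H_I. *)
Definition Hsub (K : fieldType) (disp : Order.disp_t) (I : orderType disp)
    (h : K) (J : {pred I}) : HI I h -> Prop :=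
  subalg_gen (fun a => exists2 i, i \in J & a = gx h i \/ a = gy h i).

(* The copy of Q_J inside Q_I. *)
Definition Qsub (K : fieldType) (disp : Order.disp_t) (I : orderType disp)
    (h : K) (Q : unitAlgType K) (iota : HI I h -> Q) (J : {pred I}) (q : Q) :
    Prop :=
  exists a b, [/\ Hsub J a, Hsub J b, b != 0 & q = iota a / iota b].

(* Only c 0, ..., c n occur; S always contains 0, so requiring S (c i) for
   every i is no restriction. *)
Definition nform (K : fieldType) (A : algType K) (u : Uh_ops A)
    (S : A -> Prop) (x y : A) (n : nat) (f : A) : Prop :=
  [/\ f != 0, is_invariant u f &
      exists c : nat -> A, (forall i, S (c i)) /\
        f = \sum_(i < n.+1) 'C(n, i)%:R *: (x ^+ (n - i) * y ^+ i * c i)].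

Definition bracket (K : fieldType) (disp : Order.disp_t) (I : orderType disp)
    (h : K) (i j : I) : HI I h :=
  gx h i * gy h j - gy h i * gx h j - h *: (gy h i * gy h j).

Definition projective_coordinate (K : fieldType) (A : unitAlgType K) (h : K)
    (S : A -> Prop) (x y l z : A) : Prop :=
  exists X Y, [/\ S X, S Y, Y != 0, l = x * Y - y * X - h *: (y * Y)
                & z = X / Y + (h / 2)%:A].

Section Polarization.
Variables (K : fieldType) (disp : Order.disp_t) (I : orderType disp) (h : K).

(* A word in the letters x_i = (i, true) and y_i = (i, false). *)
Definition word (w : seq (I * bool)) : HI I h :=
  \prod_(l <- w) (if l.2 then gx h l.1 else gy h l.1).

Definition homogeneous (k : I) (m : nat) (a : HI I h) : Prop :=
  exists s : seq (K * seq (I * bool)),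
    all (fun p => count (fun l => l.1 == k) p.2 == m) s /\
    a = \sum_(p <- s) p.1 *: word p.2.

Record polar_derivation (k l : I) (D : HI I h -> HI I h) : Prop := {
  pd_lin : linear D;
  pd_der : forall a b, D (a * b) = D a * b + a * D b;
  pd_x : forall i, D (gx h i) = if i == k then gx h l else 0;
  pd_y : forall i, D (gy h i) = if i == k then gy h l else 0
}.

(* P_kl, for D = Delta_kl.  The degree m is unique when a <> 0; the value is 0
   when a = 0, and the junk value D a / 0 = 0 when a is not homogeneous. *)
Definition polar (k : I) (D : HI I h -> HI I h) (a : HI I h) : HI I h :=
  (xget 0%N [set m | homogeneous k m a])%:R^-1 *: D a.

End Polarization.

Section Covariants.
Variables (K : fieldType) (R : algType K) (h : K).
Implicit Types (x y A B C D : R).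

Definition cubic x y A B C D : R :=
  x ^+ 3 * A + 3 *: (x ^+ 2 * y * B) + 3 *: (x * y ^+ 2 * C) + y ^+ 3 * D.

Definition covK A B C D : R :=
  2 *: (A * C) - 2 *: B ^+ 2 - (4 * h) *: (A * B) + (2 * h ^+ 2) *: A ^+ 2.

Definition covL A B C D : R :=
  2 *: (A * D) - 2 *: (B * C) - (2 * h) *: (A * C)
  + (4 * h ^+ 2) *: (A * B) - (2 * h ^+ 3) *: A ^+ 2.

Definition covM A B C D : R :=
  2 *: (B * D) - 2 *: C ^+ 2 - (4 * h) *: (A * D) + (6 * h ^+ 2) *: B ^+ 2
  - (6 * h ^+ 3) *: (A * B) + (8 * h ^+ 4) *: A ^+ 2.

Definition hessian x y A B C D : R :=
  2^-1 *: (x ^+ 2 * covK A B C D + x * y * covL A B C D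
           + y ^+ 2 * covM A B C D).

Definition discriminant A B C D : R :=
  let k := covK A B C D in
  let l := covL A B C D in
  let m := covM A B C D in
  2^-1 *: (2 *: (k * m) - 2^-1 *: l ^+ 2 - h *: (k * l)
           + (3 * h ^+ 2 / 2) *: k ^+ 2).

Definition covS A B C D : R :=
  A ^+ 2 * D - 3 *: (A * B * C) + 2 *: B ^+ 3 + (9 * h) *: (A * B ^+ 2)
  - (2 * h ^+ 2) *: (A ^+ 2 * B) + (6 * h ^+ 3) *: A ^+ 3.

Definition cubic_covariant (u : Uh_ops R) x y A B C D (j : R) : Prop :=
  let P := subalg_gen (fun a => [\/ a = A, a = B, a = C | a = D]) in
  is_invariant u j /\
  exists S1 S2 S3, [/\ P S1, P S2, P S3 &
    j = x ^+ 3 * covS A B C D + x ^+ 2 * y * S1 + x * y ^+ 2 * S2 + y ^+ 3 * S3].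

(* The coefficients of P_01^2 f = x delta - y gamma - h y delta.  The
   coefficient of y is - [cardano_gamma0], hence
   gamma = [cardano_gamma0] - h delta. *)
Definition cardano_delta (x1 y1 A B C D : R) : R :=
  x1 ^+ 2 * A + x1 * y1 * (2 *: B - h *: A)
  + y1 ^+ 2 * (C - h *: B + h ^+ 2 *: A).

Definition cardano_gamma0 (x1 y1 A B C D : R) : R :=
  - (x1 ^+ 2 * (B + h *: A)) - x1 * y1 * (2 *: C + (3 * h) *: B + h ^+ 2 *: A)
  - y1 ^+ 2 * (D + (2 * h) *: C + h ^+ 2 *: B - h ^+ 3 *: A).

Definition cardano_gamma (x1 y1 A B C D : R) : R :=
  cardano_gamma0 x1 y1 A B C D - h *: cardano_delta x1 y1 A B C D.

End Covariants.

Record cardano_extension (K : fieldType) (Q L : unitAlgType K)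
    (kappa : {lrmorphism Q -> L}) (d f1 j1 D1 : Q) (s u1 u2 : L) : Prop := {
  ce_div : division_ring L;
  ce_s : is_central s;
  ce_u1 : is_central u1;
  ce_u2 : is_central u2;
  ce_sqr : s ^+ 2 = - kappa d;
  ce_cube1 : u1 ^+ 3 = 2^-1 *: (kappa j1 + kappa f1 * s);
  ce_cube2 : u2 ^+ 3 = 2^-1 *: (kappa j1 - kappa f1 * s);
  ce_prod : u1 * u2 = - kappa D1;
  ce_gen : forall l : L,
    divalg_gen (fun a => (exists q, a = kappa q) \/ [\/ a = s, a = u1 | a = u2]) l
}.

(* The division subring of L generated by Q_J and s, u1, u2. *)
Definition Lsub (K : fieldType) (disp : Order.disp_t) (I : orderType disp)
    (h : K) (Q L : unitAlgType K) (iota : HI I h -> Q) (kappa : Q -> L)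
    (s u1 u2 : L) (J : {pred I}) : L -> Prop :=
  divalg_gen (fun a => (exists2 q, Qsub iota J q & a = kappa q)
                       \/ [\/ a = s, a = u1 | a = u2]).

Definition cardano_action (K : fieldType) (h : K) (Q L : unitAlgType K)
    (kappa : Q -> L) (uQ : Uh_ops Q) (uL : Uh_ops L) (s u1 u2 : L) : Prop :=
  action_extends h kappa uQ uL /\
  forall t, t \in [:: s; u1; u2] -> is_invariant uL t /\ opK uL t = t.

(* Main.v *)
(** Modulo the two-sided ideal generated by y_k, an element a commutes with x_k
    up to e^{-hF}: this gives an action of H_I / (y_k) on H_I, hence the
    independence of the monomials in x_k, y_k over the other generators, and
    shows that a form in x_k, y_k annihilated by E vanishes as soon as its
    leading coefficient does.  Invariant elements are central, and comparing
    the coefficients of a f = f a gives the commutation relations of A, B, C, D.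
    The identity for f f_1^2 is an identity of invariant sextic forms in x_1,
    y_1; comparing leading coefficients reduces it to the syzygy
    a^2 f = (ax + by)^3 + 3 H (ax + by) y^2 + S y^3 (completing the cube).
    The factorization is then the classical Cardano formula for the central
    elements xi, eta, u_1, u_2, with C_0 = f_1^{-2}.  Finally
    delta - r y_1 is nonzero for each root r: otherwise the coefficient of x^3
    in the identity gives A f_1^2 = 0, whence f = 0. *)

Require Import Defs.
From mathcomp Require Import all_boot all_order all_algebra.
From mathcomp Require Import boolp classical_sets reals trigo complex.
From mathcomp Require Import ring lra.

Set Implicit Arguments.
Unset Strict Implicit.
Unset Printing Implicit Defensive.

Import Order.TTheory GRing.Theory Num.Theory.
Local Open Scope ring_scope.

(** * Rewriting of noncommutative polynomials *)

(** H_I is given by a presentation only, with no basis of ordered monomials at hand, so coefficients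
    cannot be compared directly. The action modulo y_k stands in for a basis: it reads off the
    leading coefficient of a form up to the automorphism e^{hF}, and because H_I is a domain the
    factor y_k of the remainder cancels, which exposes the next coefficient. For an element killed
    by E the lower coefficients need not be known: E sends y_k^m to m y_k^{m-1} x_k plus a multiple
    of y_k^m, so in characteristic 0 the vanishing of one coefficient forces that of the next. This
    is why the identity for f f_1^2 is accessible although only the leading coefficient of j is
    explicit. Explicit identities are checked by normalizing words over Z[h]. The rewriting rules
    only have to be true equations; confluence and termination never enter, since a normal form
    merely certifies that a difference is zero. *)

Module NC.

Inductive sexpr : Type :=
| SPar
| SNat of nat
| SAdd of sexpr & sexpr
| SMul of sexpr & sexpr
| SOpp of sexpr
| SPow of sexpr & nat.

Inductive expr : Type :=
| Var of nat
| Nat of nat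
| Add of expr & expr
| Mul of expr & expr
| Opp of expr
| Pow of expr & nat
| Scale of sexpr & expr.

(** [(c, k)] stands for c h^k, so a coefficient polynomial in h is spread over several monomials
    with the same word. A word lists positions of letters in the environment. *)
Definition coef := (int * nat)%type.
Definition poly := seq (coef * seq nat).
Definition rules := seq ((nat * nat) * poly).

Definition add1 (m : coef * seq nat) : poly -> poly :=
  fix add1 p :=
    match p with
    | [::] => [:: m]
    | m' :: p' =>
      if (m.1.2 == m'.1.2) && (m.2 == m'.2) then
        let c := m.1.1 + m'.1.1 in
        if c == 0 then p' else ((c, m.1.2), m.2) :: p'
      else m' :: add1 p'
    end.

Definition padd (p q : poly) : poly := foldr add1 q p.

Definition pscale (c : coef) (p : poly) : poly :=
  map (fun m => ((c.1 * m.1.1, (c.2 + m.1.2)%N), m.2)) p.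

Definition bind (f : seq nat -> poly) (p : poly) : poly :=
  foldr (fun m r => padd (pscale m.1 (f m.2)) r) [::] p.

Fixpoint find_rule (rs : rules) (a b : nat) : option poly :=
  match rs with
  | [::] => None
  | r :: rs' => if (r.1.1 == a) && (r.1.2 == b) then Some r.2
                else find_rule rs' a b
  end.

(** The word [w] is expected to be reduced already, so only the junction of [a] with its first
    letter is inspected; the letters of the right-hand side are then multiplied back onto the tail
    one at a time. [n] bounds the depth. Soundness rests on neither. *)
Fixpoint lmul (rs : rules) (n : nat) (a : nat) (w : seq nat) : poly :=
  match n, w with
  | n'.+1, b :: w' =>
    match find_rule rs a b with
    | Some r =>
      bind (foldr (fun l q => bind (lmul rs n' l) q) [:: ((1, 0%N), w')]) r
    | None => [:: ((1, 0%N), a :: w)]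
    end
  | _, _ => [:: ((1, 0%N), a :: w)]
  end.

Definition wmul rs n (w : seq nat) (q : poly) : poly :=
  foldr (fun l => bind (lmul rs n l)) q w.

Definition pmul rs n (p q : poly) : poly := bind (wmul rs n ^~ q) p.

Definition ppow rs n (p : poly) (k : nat) : poly :=
  iter k (pmul rs n p) [:: ((1, 0%N), [::])].

Fixpoint snorm (s : sexpr) : poly :=
  match s with
  | SPar => [:: ((1, 1%N), [::])]
  | SNat k => [:: ((k%:Z, 0%N), [::])]
  | SAdd s t => padd (snorm s) (snorm t)
  | SMul s t => pmul [::] 0 (snorm s) (snorm t)
  | SOpp s => pscale (-1, 0%N) (snorm s)
  | SPow s k => ppow [::] 0 (snorm s) k
  end.

Fixpoint norm rs n (e : expr) : poly :=
  match e with
  | Var k => [:: ((1, 0%N), [:: k])]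
  | Nat k => [:: ((k%:Z, 0%N), [::])]
  | Add s t => padd (norm rs n s) (norm rs n t)
  | Mul s t => pmul rs n (norm rs n s) (norm rs n t)
  | Opp s => pscale (-1, 0%N) (norm rs n s)
  | Pow s k => ppow rs n (norm rs n s) k
  | Scale s t => pmul rs n (snorm s) (norm rs n t)
  end.

Definition erules := seq ((nat * nat) * expr).

(** Right-hand sides are only expanded here; they get reduced when [lmul] multiplies them back. *)
Definition norm_rules (ers : erules) : rules :=
  map (fun r => (r.1, norm [::] 0 r.2)) ers.

(* The depth bound 100 of the rewriting is never reached in practice; beyond it
   a word is left as it is, which is sound. *)
Definition check (ers : erules) (s t : expr) : bool :=
  let rs := norm_rules ers in
  all (fun m => m.1.1 == 0) (norm rs 100 (Add s (Opp t))).

(** * Soundness of the normalization *)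

Section Semantics.
Variables (K : comNzRingType) (A : algType K) (h : K) (env : seq A).

Fixpoint seval (s : sexpr) : K :=
  match s with
  | SPar => h
  | SNat k => k%:R
  | SAdd s t => seval s + seval t
  | SMul s t => seval s * seval t
  | SOpp s => - seval s
  | SPow s k => seval s ^+ k
  end.

Fixpoint eval (e : expr) : A :=
  match e with
  | Var k => nth 0 env k
  | Nat k => k%:R
  | Add s t => eval s + eval t
  | Mul s t => eval s * eval t
  | Opp s => - eval s
  | Pow s k => eval s ^+ k
  | Scale s t => seval s *: eval t
  end.

Definition ceval (c : coef) : K := c.1%:~R * h ^+ c.2.
Definition weval (w : seq nat) : A := foldr (fun a r => nth 0 env a * r) 1 w.
Definition peval (p : poly) : A :=
  foldr (fun m r => ceval m.1 *: weval m.2 + r) 0 p.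

Fixpoint valid (ers : erules) : Prop :=
  match ers with
  | [::] => True
  | r :: ers' => nth 0 env r.1.1 * nth 0 env r.1.2 = eval r.2 /\ valid ers'
  end.

Fixpoint pvalid (rs : rules) : Prop :=
  match rs with
  | [::] => True
  | r :: rs' => nth 0 env r.1.1 * nth 0 env r.1.2 = peval r.2 /\ pvalid rs'
  end.

Lemma peval_add1 m p : peval (add1 m p) = ceval m.1 *: weval m.2 + peval p.
Proof.
case: m => -[c k] w; elim: p => //= -[[c' k'] w'] p IH /=.
case: ifP => [/andP[/eqP -> /eqP ->]|_] /=; last by rewrite IH addrCA.
have E : ceval (c + c', k') = ceval (c, k') + ceval (c', k').
  by rewrite /ceval /= rmorphD mulrDl.
by case: eqP => [c0|_] /=; rewrite addrA -scalerDl -E // /ceval /= c0 mul0r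
  scale0r add0r.
Qed.

Lemma peval_padd p q : peval (padd p q) = peval p + peval q.
Proof. by elim: p => [|m p IH] /=; rewrite ?add0r // peval_add1 IH addrA. Qed.

Lemma peval_pscale c p : peval (pscale c p) = ceval c *: peval p.
Proof.
elim: p => [|m p IH] /=; first by rewrite scaler0.
rewrite IH scalerDr scalerA; congr (_ *: _ + _).
by rewrite /ceval /= rmorphM exprD mulrACA.
Qed.

Lemma peval_bind f a p : (forall w, peval (f w) = a * weval w) ->
  peval (bind f p) = a * peval p.
Proof.
move=> fE; elim: p => [|m p IH] /=; first by rewrite mulr0.
by rewrite peval_padd peval_pscale IH fE mulrDr -scalerAr.
Qed.

Lemma peval_bindl f a p : (forall w, peval (f w) = weval w * a) ->
  peval (bind f p) = peval p * a.
Proof.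
move=> fE; elim: p => [|m p IH] /=; first by rewrite mul0r.
by rewrite peval_padd peval_pscale IH fE mulrDl -scalerAl.
Qed.

Lemma peval_word w : peval [:: ((1, 0%N), w)] = weval w.
Proof. by rewrite /= /ceval /= mulr1 scale1r addr0. Qed.

Section Rules.
Variables (rs : rules) (rsP : pvalid rs).

Lemma find_ruleP a b r : find_rule rs a b = Some r ->
  nth 0 env a * nth 0 env b = peval r.
Proof.
elim: rs rsP => //= -[[a' b'] r'] rs' IH [E V] /=.
by case: ifP => [/andP[/eqP <- /eqP <-] [<-]|_]; [|exact: IH].
Qed.

Lemma peval_lmul n a w : peval (lmul rs n a w) = nth 0 env a * weval w.
Proof.
elim: n a w => [|n IH] a [|b w]; rewrite ?peval_word //.
rewrite /lmul -/(lmul rs n).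
case R: (find_rule rs a b) => [r|]; last by rewrite peval_word.
rewrite [weval (b :: w)]/= mulrA (find_ruleP R); apply: peval_bindl => u.
elim: u => [|c u IHu]; first by rewrite peval_word mul1r.
by rewrite /= (peval_bind _ (IH c)) IHu mulrA.
Qed.

Lemma peval_wmul n w q : peval (wmul rs n w q) = weval w * peval q.
Proof.
elim: w => [|a w IH] /=; first by rewrite mul1r.
by rewrite (peval_bind _ (peval_lmul n a)) IH mulrA.
Qed.

Lemma peval_pmul n p q : peval (pmul rs n p q) = peval p * peval q.
Proof. by apply: peval_bindl => w; exact: peval_wmul. Qed.

Lemma peval_ppow n p k : peval (ppow rs n p k) = peval p ^+ k.
Proof.
elim: k => [|k IH]; first exact: peval_word.
by rewrite /ppow iterS peval_pmul IH exprS.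
Qed.

End Rules.

Lemma peval_snorm s : peval (snorm s) = (seval s)%:A.
Proof.
elim: s => /= [|k|s IHs t IHt|s IHs t IHt|s IHs|s IHs k].
- by rewrite /ceval /= mul1r addr0.
- by rewrite /ceval /= mulr1 addr0.
- by rewrite peval_padd IHs IHt scalerDl.
- by rewrite peval_pmul // IHs IHt -scalerAl mul1r scalerA.
- by rewrite peval_pscale IHs /ceval /= mulr1 mulrN1z scaleN1r scaleNr.
- by rewrite peval_ppow // IHs -in_algE -rmorphXn.
Qed.

Lemma peval_norm rs n e : pvalid rs -> peval (norm rs n e) = eval e.
Proof.
move=> rsP; elim: e => /= [k|k|s IHs t IHt|s IHs t IHt|s IHs|s IHs k|s t IHt].
- by rewrite mulr1 /ceval /= mulr1 scale1r addr0.
- by rewrite /ceval /= mulr1 addr0 scaler_nat.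
- by rewrite peval_padd IHs IHt.
- by rewrite peval_pmul // IHs IHt.
- by rewrite peval_pscale IHs /ceval /= mulr1 mulrN1z scaleN1r.
- by rewrite peval_ppow // IHs.
- by rewrite peval_pmul // IHt peval_snorm -scalerAl mul1r.
Qed.

Lemma valid_norm_rules ers : valid ers -> pvalid (norm_rules ers).
Proof.
elim: ers => //= -[ab e] ers IH [/= E /IH V]; split=> //=.
by rewrite peval_norm.
Qed.

Lemma check_correct ers s t : valid ers -> check ers s t -> eval s = eval t.
Proof.
move=> V; apply: contraTeq => ne.
apply: contra ne => /allP z; rewrite -subr_eq0.
have E : _ = eval s - eval t :=
  peval_norm 100 (Add s (Opp t)) (valid_norm_rules V).
rewrite -{}E; move: z; move: (norm _ _ _) => p; elim: p => //= m p IH z.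
rewrite {1}/ceval (eqP (z m _)) ?mem_head // mul0r scale0r add0r.
by apply: IH => m' m'p; apply: z; rewrite inE m'p orbT.
Qed.

End Semantics.

(** * Reification of goals and of rewriting rules *)

Ltac lookup a env :=
  lazymatch env with
  | a :: _ => constr:(0%N)
  | _ :: ?env' => let k := lookup a env' in constr:(S k)
  end.

Ltac reify_scalar h c :=
  lazymatch c with
  | h => constr:(SPar)
  | @GRing.zero _ => constr:(SNat 0)
  | @GRing.one _ => constr:(SNat 1)
  | GRing.natmul ?a ?n =>
    lazymatch a with @GRing.one _ => constr:(SNat n) end
  | GRing.add ?a ?b =>
    let a' := reify_scalar h a in let b' := reify_scalar h b in
    constr:(SAdd a' b')
  | GRing.mul ?a ?b =>
    let a' := reify_scalar h a in let b' := reify_scalar h b in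
    constr:(SMul a' b')
  | GRing.opp ?a => let a' := reify_scalar h a in constr:(SOpp a')
  | GRing.exp ?a ?n => let a' := reify_scalar h a in constr:(SPow a' n)
  end.

Ltac reify h env e :=
  lazymatch e with
  | @GRing.zero _ => constr:(Nat 0)
  | @GRing.one _ => constr:(Nat 1)
  | GRing.natmul ?a ?n =>
    lazymatch a with @GRing.one _ => constr:(Nat n) end
  | GRing.add ?a ?b =>
    let a' := reify h env a in let b' := reify h env b in constr:(Add a' b')
  | GRing.mul ?a ?b =>
    let a' := reify h env a in let b' := reify h env b in constr:(Mul a' b')
  | GRing.opp ?a => let a' := reify h env a in constr:(Opp a')
  | GRing.exp ?a ?n => let a' := reify h env a in constr:(Pow a' n)
  | GRing.scale ?c ?a =>
    let c' := reify_scalar h c in let a' := reify h env a in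
    constr:(Scale c' a')
  | _ => let k := lookup e env in constr:(Var k)
  end.

Ltac reify_rules h env T :=
  lazymatch T with
  | True => constr:([::] : erules)
  | (GRing.mul ?a ?b = ?r) /\ ?T' =>
    let a' := lookup a env in let b' := lookup b env in
    let r' := reify h env r in
    let rs := reify_rules h env T' in
    constr:((((a', b'), r') :: rs) : erules)
  end.

End NC.

(* [env] lists the atoms, coefficients lie in Z[h], and [rs] proves the
   conjunction, closed by [True], of the rewriting rules a * b = p. *)
Ltac ncring h env rs :=
  lazymatch goal with
  | |- ?s = ?t =>
    let s' := NC.reify h env s in let t' := NC.reify h env t in
    let T := type of rs in
    let ers := NC.reify_rules h env T in
    exact (@NC.check_correct _ _ h env ers s' t' rs
             (@erefl bool true <: NC.check ers s' t' = true))
  end.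


(** * Commutation in H_I and the action *)

Section Generators.
Variables (K : numFieldType) (disp : Order.disp_t) (I : orderType disp).
Variable h : K.
Local Notation H := (HI I h).
Local Notation x := (gx (I := I) h).
Local Notation y := (gy (I := I) h).

Lemma HI_ind (P : H -> Prop) :
  (forall c : K, P c%:A) -> (forall i, P (x i)) -> (forall i, P (y i)) ->
  (forall a b, P a -> P b -> P (a + b)) ->
  (forall a b, P a -> P b -> P (a * b)) ->
  forall a, P a.
Proof.
move=> PC Px Py PD PM; apply: hpi_ind.
elim=> [i|i|c|s Ps t Pt|s Ps t Pt].
- exact: Px.
- exact: Py.
- have -> : hpi h (TC I c) = c%:A; last exact: PC.
  rewrite hpiZ; apply/hpiP.
  by apply: hc_trans (hc_sym (hc_mul1 _ _)) (hc_cstC _ _ _).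
- by rewrite -hpiD; exact: PD.
- by rewrite -hpiM; exact: PM.
Qed.

(* The defining relations do not depend on the order of [I]. *)
Lemma gyy i j : y j * y i = y i * y j.
Proof.
have [_ _ _ yy _] := gxyP I h.
by have [/yy|/yy ->|->] := ltgtP i j.
Qed.

Lemma gxy i j : x j * y i = y i * x j + h *: (y i * y j).
Proof.
have [self xy yx _ _] := gxyP I h.
have [/xy|/yx ->|->] := ltgtP i j; [by []| |exact: self].
by rewrite gyy subrK.
Qed.

Lemma gyx i j : y j * x i = x i * y j - h *: (y i * y j).
Proof. by rewrite gxy gyy addrK. Qed.

Lemma gxx i j : x j * x i = x i * x j - h *: (x i * y j) + h *: (y i * x j)
                + h ^+ 2 *: (y i * y j).
Proof.
have [_ _ _ _ xx] := gxyP I h.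
have [/xx|ji|->] := ltgtP i j; first by [].
  have R : y i * x j = x j * y i - h *: (y j * y i) /\
    (y j * x i = x i * y j - h *: (y i * y j) /\
    (y i * y j = y j * y i /\
    (x i * x j = x j * x i - h *: (x j * y i) + h *: (y j * x i)
                + h ^+ 2 *: (y j * y i) /\ True))).
    by do !split; [exact: gyx|exact: gyx|exact: gyy|exact: xx].
  by let e := constr:([:: x i; y i; x j; y j]) in ncring h e R.
have R : y j * x j = x j * y j - h *: (y j * y j) /\ True by rewrite gyx.
by let e := constr:([:: x j; y j]) in ncring h e R.
Qed.

End Generators.

Section LinearFunctions.
Variables (K : pzRingType) (V : lmodType K) (f : V -> V).
Hypothesis fL : linear f.

Lemma linear_add : {morph f : a b / a + b}.
Proof. by move=> a b; have := fL 1 a b; rewrite !scale1r. Qed.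

Lemma linear_zero : f 0 = 0.
Proof. by have := fL (-1) 0 0; rewrite scaler0 addr0 scaleN1r addNr. Qed.

Lemma linear_scale c a : f (c *: a) = c *: f a.
Proof. by have := fL c a 0; rewrite linear_zero !addr0. Qed.

Lemma linear_opp a : f (- a) = - f a.
Proof. by rewrite -!scaleN1r linear_scale. Qed.

End LinearFunctions.

Section Action.
Variables (K : numFieldType) (disp : Order.disp_t) (I : orderType disp).
Variables (h : K) (u : Uh_ops (HI I h)).
Hypothesis uP : HI_action u.
Local Notation H := (HI I h).
Local Notation x := (gx (I := I) h).
Local Notation y := (gy (I := I) h).
Local Notation E := (opE u).
Local Notation F := (opF u).
Local Notation Hop := (opH u).
Local Notation Kop := (opK u).
Local Notation KV := (opKV u).

Let uMA := ha_ma uP.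

Lemma opED a b : E (a + b) = E a + E b.
Proof. exact: linear_add (ma_linE uMA) a b. Qed.
Lemma opFD a b : F (a + b) = F a + F b.
Proof. exact: linear_add (ma_linF uMA) a b. Qed.
Lemma opHD a b : Hop (a + b) = Hop a + Hop b.
Proof. exact: linear_add (ma_linH uMA) a b. Qed.
Lemma opKD a b : Kop (a + b) = Kop a + Kop b.
Proof. exact: linear_add (ma_linK uMA) a b. Qed.
Lemma opKVD a b : KV (a + b) = KV a + KV b.
Proof. exact: linear_add (ma_linKV uMA) a b. Qed.
Lemma opEN a : E (- a) = - E a. Proof. exact: linear_opp (ma_linE uMA) a. Qed.
Lemma opFN a : F (- a) = - F a. Proof. exact: linear_opp (ma_linF uMA) a. Qed.
Lemma opKN a : Kop (- a) = - Kop a. Proof. exact: linear_opp (ma_linK uMA) a. Qed.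
Lemma opKVN a : KV (- a) = - KV a. Proof. exact: linear_opp (ma_linKV uMA) a. Qed.
Lemma opEZ c a : E (c *: a) = c *: E a.
Proof. exact: linear_scale (ma_linE uMA) c a. Qed.
Lemma opFZ c a : F (c *: a) = c *: F a.
Proof. exact: linear_scale (ma_linF uMA) c a. Qed.
Lemma opHZ c a : Hop (c *: a) = c *: Hop a.
Proof. exact: linear_scale (ma_linH uMA) c a. Qed.
Lemma opKZ c a : Kop (c *: a) = c *: Kop a.
Proof. exact: linear_scale (ma_linK uMA) c a. Qed.
Lemma opKVZ c a : KV (c *: a) = c *: KV a.
Proof. exact: linear_scale (ma_linKV uMA) c a. Qed.
Lemma opE0 : E 0 = 0. Proof. exact: linear_zero (ma_linE uMA). Qed.
Lemma opF0 : F 0 = 0. Proof. exact: linear_zero (ma_linF uMA). Qed.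
Lemma opK0 : Kop 0 = 0. Proof. exact: linear_zero (ma_linK uMA). Qed.
Lemma opKV0 : KV 0 = 0. Proof. exact: linear_zero (ma_linKV uMA). Qed.

Lemma opEM a b : E (a * b) = E a * KV b + Kop a * E b.
Proof. exact: ma_EM uMA a b. Qed.
Lemma opFM a b : F (a * b) = F a * b + a * F b.
Proof. exact: ma_FM uMA a b. Qed.
Lemma opHM a b : Hop (a * b) = Hop a * KV b + Kop a * Hop b.
Proof. exact: ma_HM uMA a b. Qed.
Lemma opKM a b : Kop (a * b) = Kop a * Kop b.
Proof. exact: ma_KM uMA a b. Qed.
Lemma opKVM a b : KV (a * b) = KV a * KV b.
Proof. exact: ma_KVM uMA a b. Qed.
Lemma opK1 : Kop 1 = 1. Proof. exact: ma_K1 uMA. Qed.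
Lemma opKV1 : KV 1 = 1. Proof. exact: ma_KV1 uMA. Qed.
Lemma opEx i : E (x i) = 0. Proof. exact: ha_Ex uP i. Qed.
Lemma opEy i : E (y i) = x i. Proof. exact: ha_Ey uP i. Qed.
Lemma opFx i : F (x i) = y i. Proof. exact: ha_Fx uP i. Qed.
Lemma opFy i : F (y i) = 0. Proof. exact: ha_Fy uP i. Qed.
Lemma opHx i : Hop (x i) = x i. Proof. exact: ha_Hx uP i. Qed.
Lemma opHy i : Hop (y i) = - y i. Proof. exact: ha_Hy uP i. Qed.

Lemma opK_ker a : F a = 0 -> Kop a = a.
Proof.
move=> Fa; rewrite (ha_K uP (n := 1)) // big_ord1 /=.
by rewrite expr0 fact0 divr1 scale1r.
Qed.

Lemma opKV_ker a : F a = 0 -> KV a = a.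
Proof. by move=> Fa; rewrite -{1}(opK_ker Fa) (ma_KK uMA). Qed.

Lemma opK_ker2 a : F (F a) = 0 -> Kop a = a + h *: F a.
Proof.
move=> FFa; rewrite (ha_K uP (n := 2)) // big_ord_recl big_ord1 /=.
by rewrite expr0 expr1 fact0 !divr1 scale1r.
Qed.

Lemma opKV_ker2 a : F (F a) = 0 -> KV a = a - h *: F a.
Proof.
move=> FFa; rewrite (ha_KV uP (n := 2)) // big_ord_recl big_ord1 /=.
by rewrite expr0 expr1 fact0 !divr1 scale1r scaleNr.
Qed.

(** [b] and [c] are the divided powers F^2 a / 2! and F^3 a / 3!; supplying them keeps the
    exponential sum free of denominators, as [ncring] requires. *)
Lemma opK_ker4 a b c : F (F a) = 2 *: b -> F b = 3 *: c -> F c = 0 ->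
  Kop a = a + h *: F a + h ^+ 2 *: b + h ^+ 3 *: c.
Proof.
move=> FFa Fb Fc.
rewrite (ha_K uP (n := 4)) /=; last by rewrite FFa !(opFZ, Fb, Fc) !scaler0.
rewrite !big_ord_recl big_ord0 /= FFa opFZ Fb !scalerA expr0 expr1 addr0 !addrA.
congr (_ + _ *: _ + _ *: _ + _ *: _); rewrite ?divr1 ?scale1r //=.
  by apply: divfK; rewrite pnatr_eq0.
by rewrite -natrM; apply: divfK; rewrite pnatr_eq0.
Qed.

Lemma opKV_ker4 a b c : F (F a) = 2 *: b -> F b = 3 *: c -> F c = 0 ->
  KV a = a - h *: F a + h ^+ 2 *: b - h ^+ 3 *: c.
Proof.
move=> FFa Fb Fc.
rewrite (ha_KV uP (n := 4)) /=; last by rewrite FFa !(opFZ, Fb, Fc) !scaler0.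
rewrite !big_ord_recl big_ord0 /= FFa opFZ Fb !scalerA expr0 expr1 addr0 !addrA.
rewrite -!scaleNr.
congr (_ + _ *: _ + _ *: _ + _ *: _); rewrite ?divr1 ?scale1r //=.
  by rewrite sqrrN; apply: divfK; rewrite pnatr_eq0.
have -> : - h ^+ 3 = (- h) ^+ 3 by ring.
rewrite -natrM.
by apply: divfK; rewrite pnatr_eq0.
Qed.

Lemma opKx i : Kop (x i) = x i + h *: y i.
Proof. by rewrite opK_ker2 ?opFx ?opFy. Qed.
Lemma opKVx i : KV (x i) = x i - h *: y i.
Proof. by rewrite opKV_ker2 ?opFx ?opFy. Qed.
Lemma opKy i : Kop (y i) = y i.
Proof. by rewrite opK_ker ?opFy. Qed.
Lemma opKVy i : KV (y i) = y i.
Proof. by rewrite opKV_ker ?opFy. Qed.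

Lemma opF1 c : F c%:A = 0. Proof. by rewrite opFZ (ma_F1 uMA) scaler0. Qed.

(** The property passes to products because [Kop] is multiplicative, so the generators decide. *)
Lemma mul_y a i : a * y i = y i * Kop a.
Proof.
elim/HI_ind: a => [c|j|j|a b IHa IHb|a b IHa IHb].
- by rewrite opKZ opK1 -scalerAl -scalerAr mul1r mulr1.
- by rewrite opKx gxy mulrDr scalerAr.
- by rewrite opKy gyy.
- by rewrite opKD mulrDl mulrDr IHa IHb.
- by rewrite -mulrA IHb mulrA IHa -mulrA opKM.
Qed.

(** This is H + sinh(hF). It obeys the same twisted Leibniz rule as H and is the operator that
    appears when x_i is moved to the left. *)
Definition opG a : H := Hop a + 2^-1 *: (Kop a - KV a).

Lemma opG_mul a b : opG (a * b) = opG a * KV b + Kop a * opG b.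
Proof.
rewrite /opG opHM opKM opKVM.
rewrite mulrDl mulrDr addrACA; congr (_ + _).
rewrite -scalerAl -scalerAr -scalerDr mulrBl mulrBr; congr (_ *: _).
by rewrite [RHS]addrC addrA subrK.
Qed.

(** With [mul_y], a braided commutativity: a generator moves to the left past any element at the
    price of acting on that element. Products follow from [opG_mul] and the multiplicativity of
    [KV], so it is enough to look at generators. *)
Lemma mul_x a i : a * x i = x i * KV a + h *: (y i * opG a).
Proof.
elim/HI_ind: a => [c|j|j|a b IHa IHb|a b IHa IHb].
- rewrite /opG opKVZ opKZ opHZ opK1 opKV1 (ma_H1 uMA) subrr scaler0.
  by rewrite scaler0 addr0 mulr0 scaler0 addr0 -scalerAl -scalerAr mul1r mulr1.
- have -> : opG (x j) = x j + h *: y j.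
    rewrite /opG opHx opKx opKVx.
    have -> : x j + h *: y j - (x j - h *: y j) = (2 * h) *: y j.
      by let e := constr:([:: x j; y j]) in ncring h e Logic.I.
    by rewrite scalerA mulrA mulVf ?mul1r ?pnatr_eq0.
  rewrite gxx opKVx.
  by let e := constr:([:: x i; y i; x j; y j]) in ncring h e Logic.I.
- have -> : opG (y j) = - y j.
    by rewrite /opG opHy opKy opKVy subrr scaler0 addr0.
  by rewrite gyx opKVy mulrN scalerN.
- have -> : opG (a + b) = opG a + opG b.
    by rewrite /opG opHD opKD opKVD opprD addrACA scalerDr addrACA.
  rewrite opKVD mulrDl IHa IHb.
  by let e := constr:([:: x i; y i; KV a; KV b; opG a; opG b]) in
     ncring h e Logic.I.
- rewrite -mulrA IHb mulrDr -scalerAr !mulrA IHa mul_y opG_mul opKVM.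
  by let e := constr:([:: x i; y i; KV a; KV b; opG a; opG b; Kop a]) in
     ncring h e Logic.I.
Qed.

Lemma invariant_K a : is_invariant u a -> Kop a = a.
Proof. by case=> _ Fa _; exact: opK_ker. Qed.

Lemma invariant_KV a : is_invariant u a -> KV a = a.
Proof. by case=> _ Fa _; exact: opKV_ker. Qed.

(** On an invariant [Kop] and [KV] are the identity and [opG] is zero, so [mul_x] and [mul_y] become
    plain commutation with the generators. *)
Lemma invariant_central a : is_invariant u a -> is_central a.
Proof.
move=> aI b; have [_ Fa Ha] := aI.
elim/HI_ind: b => [c|i|i|b c IHb IHc|b c IHb IHc].
- by rewrite -scalerAl -scalerAr mul1r mulr1.
- rewrite mul_x invariant_KV // /opG Ha invariant_K // invariant_KV // subrr.
  by rewrite scaler0 addr0 mulr0 scaler0 addr0.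
- by rewrite mul_y invariant_K.
- by rewrite mulrDl mulrDr IHb IHc.
- by rewrite mulrA IHb -mulrA IHc mulrA.
Qed.

Lemma invariant_EF a : E a = 0 -> F a = 0 -> is_invariant u a.
Proof.
move=> Ea Fa; split=> //.
by rewrite -(ma_EF uMA) Ea Fa opE0 opF0 subrr.
Qed.

Lemma invariantZ c a : is_invariant u a -> is_invariant u (c *: a).
Proof. by case=> Ea Fa Ha; split; rewrite ?opEZ ?opFZ ?opHZ ?Ea ?Fa ?Ha scaler0. Qed.

Lemma invariantD a b : is_invariant u a -> is_invariant u b ->
  is_invariant u (a + b).
Proof.
by case=> Ea Fa Ha [Eb Fb Hb]; split; rewrite ?opED ?opFD ?opHD ?Ea ?Fa ?Ha ?Eb ?Fb
  ?Hb addr0.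
Qed.

Lemma invariantM a b : is_invariant u a -> is_invariant u b ->
  is_invariant u (a * b).
Proof.
case=> Ea Fa Ha [Eb Fb Hb].
split; rewrite ?opEM ?opFM ?opHM ?Ea ?Fa ?Ha ?Eb ?Fb ?Hb.
all: by rewrite mul0r mulr0 addr0.
Qed.

Lemma Hsub_stable J (f : H -> H) a :
  linear f -> Hsub J (f 1) ->
  (forall i, i \in J -> Hsub J (f (x i)) /\ Hsub J (f (y i))) ->
  (forall a b, Hsub J a -> Hsub J b -> Hsub J (f a) -> Hsub J (f b) ->
     Hsub J (f (a * b))) ->
  Hsub J a -> Hsub J (f a).
Proof.
move=> fL f1 fg fM; elim=> [b [i iJ [->|->]]|c|b c _ Pb _ Pc|b c Hb Pb Hc Pc].
- by have [] := fg i iJ.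
- by have [] := fg i iJ.
- by rewrite linear_scale // -[f 1]mul1r scalerAl; apply: sg_mul => //; exact: sg_cst.
- by rewrite linear_add //; exact: sg_add.
- exact: fM.
Qed.

End Action.

(** * Forms in x_k, y_k *)

Section Forms.
Variables (K : numFieldType) (disp : Order.disp_t) (I : orderType disp).
Variables (h : K) (u : Uh_ops (HI I h)).
Hypothesis uP : HI_action u.
Local Notation H := (HI I h).
Local Notation x := (gx (I := I) h).
Local Notation y := (gy (I := I) h).
Local Notation E := (opE u).
Local Notation F := (opF u).
Local Notation Hop := (opH u).
Local Notation Kop := (opK u).
Local Notation KV := (opKV u).

Let uMA := ha_ma uP.

Lemma Hsub_gx (J : {pred I}) i : i \in J -> Hsub (h := h) J (x i).
Proof. by move=> iJ; apply: sg_gen; exists i => //; left. Qed.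

Lemma Hsub_gy (J : {pred I}) i : i \in J -> Hsub (h := h) J (y i).
Proof. by move=> iJ; apply: sg_gen; exists i => //; right. Qed.

Lemma subalg_genZ (A : algType K) (G : A -> Prop) c a :
  subalg_gen G a -> subalg_gen G (c *: a).
Proof.
by move=> Ga; rewrite -[a]mul1r scalerAl; apply: sg_mul => //; exact: sg_cst.
Qed.

Lemma subalg_genN (A : algType K) (G : A -> Prop) a :
  subalg_gen G a -> subalg_gen G (- a).
Proof. by rewrite -scaleN1r; exact: subalg_genZ. Qed.

Lemma subalg_gen0 (A : algType K) (G : A -> Prop) : subalg_gen G 0.
Proof. by rewrite -[0](scale0r (1 : A)); exact: sg_cst. Qed.

Lemma subalg_gen1 (A : algType K) (G : A -> Prop) : subalg_gen G 1.
Proof. by rewrite -[1](scale1r (1 : A)); exact: sg_cst. Qed.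

Lemma subalg_genX (A : algType K) (G : A -> Prop) a n :
  subalg_gen G a -> subalg_gen G (a ^+ n).
Proof.
move=> Ga; elim: n => [|n IH]; first exact: subalg_gen1.
by rewrite exprS; exact: sg_mul.
Qed.

Lemma Hsub_K J a : Hsub J a -> Hsub J (Kop a).
Proof.
apply: Hsub_stable (ma_linK uMA) _ _ _.
- by rewrite (opK1 uP); exact: subalg_gen1.
- move=> i iJ; rewrite (opKx uP) (opKy uP); split; last exact: Hsub_gy.
  by apply: sg_add; [exact: Hsub_gx|apply/subalg_genZ/Hsub_gy].
- by move=> ? ? ? ? ? ?; rewrite (opKM uP); exact: sg_mul.
Qed.

Lemma Hsub_KV J a : Hsub J a -> Hsub J (KV a).
Proof.
apply: Hsub_stable (ma_linKV uMA) _ _ _.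
- by rewrite (opKV1 uP); exact: subalg_gen1.
- move=> i iJ; rewrite (opKVx uP) (opKVy uP); split; last exact: Hsub_gy.
  apply: sg_add; [exact: Hsub_gx|exact/subalg_genN/subalg_genZ/Hsub_gy].
- by move=> ? ? ? ? ? ?; rewrite (opKVM uP); exact: sg_mul.
Qed.

Lemma Hsub_F J a : Hsub J a -> Hsub J (F a).
Proof.
apply: Hsub_stable (ma_linF uMA) _ _ _.
- by rewrite (ma_F1 uMA); exact: subalg_gen0.
- by move=> i iJ; rewrite (opFx uP) (opFy uP); split; [exact: Hsub_gy|exact: subalg_gen0].
- by move=> ? ? ? ? ? ?; rewrite (opFM uP); apply: sg_add; exact: sg_mul.
Qed.

Lemma Hsub_E J a : Hsub J a -> Hsub J (E a).
Proof.
apply: Hsub_stable (ma_linE uMA) _ _ _.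
- by rewrite (ma_E1 uMA); exact: subalg_gen0.
- by move=> i iJ; rewrite (opEx uP) (opEy uP); split; [exact: subalg_gen0|exact: Hsub_gx].
- move=> ? ? ? ? ? ?; rewrite (opEM uP); apply: sg_add; apply: sg_mul => //.
    exact: Hsub_KV.
  exact: Hsub_K.
Qed.

Lemma Hsub_H J a : Hsub J a -> Hsub J (Hop a).
Proof.
move=> Ja; rewrite -(ma_EF uMA); apply: sg_add; last apply: subalg_genN.
  by apply: Hsub_E; exact: Hsub_F.
by apply: Hsub_F; exact: Hsub_E.
Qed.

Lemma Hsub_G J a : Hsub J a -> Hsub J (opG u a).
Proof.
move=> Ja; apply: sg_add; [exact: Hsub_H|apply: subalg_genZ].
by apply: sg_add; [exact: Hsub_K|apply: subalg_genN; exact: Hsub_KV].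
Qed.

Lemma Hsub_sub (J J' : {pred I}) a :
  {subset J <= J'} -> Hsub (h := h) J a -> Hsub J' a.
Proof.
move=> sJ; elim=> [b [i iJ bE]|c|b c _ Pb _ Pc|b c _ Pb _ Pc].
- by apply: sg_gen; exists i => //; exact: sJ.
- exact: sg_cst.
- exact: sg_add.
- exact: sg_mul.
Qed.

(** * Reduction modulo y_k and forms in one pair of generators *)

Section Index.
Variable k : I.
Local Notation J := [pred i | i != k].

(* Modulo y_k, an element a commutes with x_k up to KV: a x_k = x_k KV(a).
   Hence H_I / (y_k) acts on H_I, x_k acting as the operator K and the other
   generators by left multiplication. *)
Fixpoint phit (t : hterm K I) (m : H) : H :=
  match t with
  | TX i => if i == k then Kop m else x i * m
  | TY i => if i == k then 0 else y i * m
  | TC c => c *: m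
  | TAdd s t => phit s m + phit t m
  | TMul s t => phit s (phit t m)
  end.

Lemma phit_linear t : linear (phit t).
Proof.
elim: t => [i|i|c|s IHs t IHt|s IHs t IHt] a m m' /=.
- by case: ifP => _; rewrite ?(opKD uP) ?(opKZ uP) // mulrDr scalerAr.
- by case: ifP => _; rewrite ?scaler0 ?addr0 // mulrDr scalerAr.
- by rewrite scalerDr !scalerA mulrC.
- by rewrite IHs IHt scalerDr addrACA.
- by rewrite IHt IHs.
Qed.

(** Modulo y_k the relations involving x_k amount to x_k x_i = (x_i + h y_i) x_k and x_k y_i = y_i
    x_k, which is exactly how the automorphism [Kop] passes a left multiplication by x_i or y_i. *)
Lemma phit_congr s t : hcongr h s t -> phit s =1 phit t.
Proof.
elim=> /=.
- by [].
- by move=> ? ? _ E m; rewrite E.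
- by move=> ? ? ? _ E _ E' m; rewrite E E'.
- by move=> ? ? ? ? _ E _ E' m; rewrite E E'.
- by move=> ? ? ? ? _ E _ E' m; rewrite E E'.
- by move=> *; move=> m; rewrite addrA.
- by move=> *; move=> m; rewrite addrC.
- by move=> ? m; rewrite scale0r add0r.
- by move=> ? m; rewrite scaleN1r addNr scale0r.
- by [].
- by move=> ? m; rewrite scale1r.
- by [].
- by move=> s' ? ? m; rewrite (linear_add (phit_linear s')).
- by move=> a b m; rewrite scalerDl.
- by move=> a b m; rewrite scalerA.
- by move=> a s' m; rewrite (linear_scale (phit_linear s')).
- move=> i m; case: (eqVneq i k) => _; first by rewrite (opK0 uP) scaler0 addr0.
  by rewrite !mulrA gxy mulrDl -scalerAl.
- move=> i j ij m; case: (eqVneq j k) => [jk|jk]; case: (eqVneq i k) => [ik|ik].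
  + by rewrite ik jk ltxx in ij.
  + by rewrite (opKM uP) (opKy uP) mulr0 scaler0 addr0.
  + by rewrite mulr0 scaler0 addr0.
  + by rewrite !mulrA gxy mulrDl -scalerAl.
- move=> i j ij m; case: (eqVneq j k) => [jk|jk]; case: (eqVneq i k) => [ik|ik].
  + by rewrite ik jk ltxx in ij.
  + by rewrite !mulr0 scaler0 addr0.
  + by rewrite (opKM uP) (opKy uP) scaler0 addr0.
  + by rewrite !mulrA gyx mulrDl -scaleNr -scalerAl.
- move=> i j ij m; case: (eqVneq j k) => [jk|jk]; case: (eqVneq i k) => [ik|ik].
  + by rewrite ik jk ltxx in ij.
  + by rewrite mulr0.
  + by rewrite mulr0.
  + by rewrite !mulrA gyy.
- move=> i j ij m; case: (eqVneq j k) => [jk|jk]; case: (eqVneq i k) => [ik|ik].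
  + by rewrite ik jk ltxx in ij.
  + rewrite !mulr0 !scaler0 !addr0 (opKM uP) (opKx uP) mulrDl scalerAl.
    by [].
  + rewrite !scaler0 !addr0 !(opKM uP) (opKx uP) (opKy uP) mulrDl scaleNr scalerAl.
    by rewrite addrK.
  + rewrite mulrA gxx.
    by let e := constr:([:: x i; y i; x j; y j; m]) in ncring h e Logic.I.
Qed.

Definition Phi (a : H) : H -> H := phit (repr a).

Lemma Phi_hpi t : Phi (hpi h t) =1 phit t.
Proof. exact/phit_congr/hcongr_repr. Qed.

Lemma PhiD a b m : Phi (a + b) m = Phi a m + Phi b m.
Proof.
elim/hpi_ind: a => s; elim/hpi_ind: b => t.
by rewrite hpiD !Phi_hpi.
Qed.

Lemma PhiM a b m : Phi (a * b) m = Phi a (Phi b m).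
Proof.
elim/hpi_ind: a => s; elim/hpi_ind: b => t.
by rewrite hpiM !Phi_hpi.
Qed.

Lemma PhiZ c a m : Phi (c *: a) m = c *: Phi a m.
Proof. by elim/hpi_ind: a => s; rewrite hpiZ !Phi_hpi. Qed.

Lemma PhiN a m : Phi (- a) m = - Phi a m.
Proof. by rewrite -!scaleN1r PhiZ. Qed.

Lemma Phi1 m : Phi 1 m = m.
Proof. by rewrite -[RHS]scale1r; exact: (Phi_hpi (TC I 1)). Qed.

Lemma Phi0 m : Phi 0 m = 0.
Proof. by rewrite -[X in Phi X](scale0r 1) PhiZ scale0r. Qed.

Lemma Phi_op0 a : Phi a 0 = 0.
Proof. by elim/hpi_ind: a => s; rewrite Phi_hpi (linear_zero (phit_linear s)). Qed.

Lemma Phi_x m : Phi (x k) m = Kop m.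
Proof. by rewrite Phi_hpi /= eqxx. Qed.

Lemma Phi_y m : Phi (y k) m = 0.
Proof. by rewrite Phi_hpi /= eqxx. Qed.

Lemma Phi_coef c m : Hsub J c -> Phi c m = c * m.
Proof.
move=> Jc; elim: Jc m => [a [i ik [->|->]]|a|a b _ IHa _ IHb|a b _ IHa _ IHb] m.
- by rewrite Phi_hpi /= (negPf ik).
- by rewrite Phi_hpi /= (negPf ik).
- by rewrite PhiZ Phi1 -scalerAl mul1r.
- by rewrite PhiD IHa IHb mulrDl.
- by rewrite PhiM IHb IHa mulrA.
Qed.

(** If y_k were zero, so would be x_k = E y_k; but x_k acts as [Kop], which fixes 1. *)
Lemma gy_neq0 : y k != 0.
Proof.
apply/eqP => y0; have := Phi_x 1.
rewrite -(opEy uP) y0 (opE0 uP) Phi0 (opK1 uP) => /eqP.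
by rewrite eq_sym oner_eq0.
Qed.

Lemma iterK_eq0 n a : iter n Kop a = 0 -> a = 0.
Proof.
elim: n => //= n IH Ka; apply: IH.
by rewrite -[LHS](ma_KK uMA) Ka (opKV0 uP).
Qed.

Lemma Phi_xn n m : Phi (x k ^+ n) m = iter n Kop m.
Proof.
by elim: n => [|n IH]; rewrite ?Phi1 // exprS PhiM IH Phi_x.
Qed.

(** Homogeneous forms in x_k, y_k with coefficients at the right end. The order of x_k and y_k is
    left free, so that closure under products and polarization is a plain induction. *)
Inductive isform : nat -> H -> Prop :=
| isform_coef c : Hsub J c -> isform 0 c
| isform_x n a : isform n a -> isform n.+1 (x k * a)
| isform_y n a : isform n a -> isform n.+1 (y k * a)
| isform_add n a b : isform n a -> isform n b -> isform n (a + b).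

Lemma isform0 n : isform n 0.
Proof.
elim: n => [|n IH]; first exact/isform_coef/subalg_gen0.
by rewrite -[0](mulr0 (x k)); exact: isform_x.
Qed.

(** By [mul_x] and [mul_y] a coefficient passes to the right of x_k and y_k, turning into its images
    under [KV], [opG] and [Kop]; these operators preserve the subalgebra without index k. *)
Lemma isform_cst n a c : Hsub J c -> isform n a -> isform n (c * a).
Proof.
move=> Jc fa; elim: fa c Jc => {n a} [d Jd|n a _ IH|n a _ IH|n a b _ IHa _ IHb] c Jc.
- exact/isform_coef/sg_mul.
- rewrite mulrA (mul_x uP) mulrDl -!scalerAl -!mulrA.
  apply: isform_add; first exact/isform_x/IH/Hsub_KV.
  by rewrite scalerAr scalerAl; apply/isform_y/IH/subalg_genZ/Hsub_G.
- by rewrite mulrA (mul_y uP) -mulrA; apply/isform_y/IH/Hsub_K.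
- by rewrite mulrDr; apply: isform_add; [exact: IHa|exact: IHb].
Qed.

Lemma isformM n m a b : isform n a -> isform m b -> isform (n + m) (a * b).
Proof.
move=> fa fb; elim: fa => {n a} [c Jc|n a _ IH|n a _ IH|n a a' _ IHa _ IHa'].
- exact: isform_cst.
- by rewrite -mulrA; exact: isform_x.
- by rewrite -mulrA; exact: isform_y.
- by rewrite mulrDl; exact: isform_add.
Qed.

Lemma isformZ n c a : isform n a -> isform n (c *: a).
Proof.
by rewrite -[a in c *: a]mul1r scalerAl; apply: isform_cst; exact: sg_cst.
Qed.

Lemma isformN n a : isform n a -> isform n (- a).
Proof. by rewrite -scaleN1r; exact: isformZ. Qed.

Lemma isformX n m a : isform n a -> isform (n * m) (a ^+ m).
Proof.
move=> fa; elim: m => [|m IH]; first by rewrite muln0; exact/isform_coef/subalg_gen1.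
by rewrite mulnS exprS; exact: isformM.
Qed.

Lemma isform_gx : isform 1 (x k).
Proof. by rewrite -[x k]mulr1; exact/isform_x/isform_coef/subalg_gen1. Qed.

Lemma isform_gy : isform 1 (y k).
Proof. by rewrite -[y k]mulr1; exact/isform_y/isform_coef/subalg_gen1. Qed.

Lemma isform_normal n a : isform n a ->
  exists c b, [/\ Hsub J c, a = x k ^+ n * c + y k * b
    & if n is n'.+1 then isform n' b else b = 0].
Proof.
elim=> {n a} [c Jc|n a fa [c [b [Jc aE fb]]]|n a fa _|].
- by exists c, 0; split=> //; rewrite mul1r mulr0 addr0.
(* The remainder uses x_k y_k = y_k (x_k + h y_k). *)
- exists c, ((x k + h *: y k) * b); split=> //.
    rewrite aE mulrDr mulrA -exprS; congr (_ + _).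
    by rewrite !mulrA gxy mulrDr -scalerAr.
  case: n fb {fa aE} => [->|n fb]; first by rewrite mulr0; exact: isform0.
  rewrite mulrDl -scalerAl; apply: isform_add; first exact: isform_x.
  exact/isformZ/isform_y.
- exists 0, a; split=> //; first exact: subalg_gen0.
  by rewrite mulr0 add0r.
- move=> n a a' fa [c [b [Jc aE fb]]] fa' [c' [b' [Jc' a'E fb']]].
  exists (c + c'), (b + b'); split; first exact: sg_add.
    by rewrite aE a'E !mulrDr addrACA.
  case: n {fa fa' aE a'E} fb fb' => [-> ->|n fb fb']; first by rewrite addr0.
  exact: isform_add.
Qed.

(** Everything to the right of a leading y_k acts as zero, so the action sees precisely the leading
    coefficient, behind an injective power of [Kop]. *)
Lemma Phi_lead n c b m : Hsub J c ->
  Phi (x k ^+ n * c + y k * b) m = iter n Kop (c * m).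
Proof.
by move=> Jc; rewrite PhiD !PhiM Phi_y (Phi_coef _ Jc) Phi_xn addr0.
Qed.

Lemma KV_xn n : exists b, KV (x k ^+ n) = x k ^+ n + y k * b.
Proof.
elim: n => [|n [b IH]]; first by exists 0; rewrite (opKV1 uP) mulr0 addr0.
exists (h *: y k * b + x k * b - h *: (x k ^+ n) - h *: (y k * b)).
rewrite exprS (opKVM uP) (opKVx uP) IH.
have R : x k * y k = y k * x k + h *: (y k * y k) /\ True by rewrite gxy.
move: (x k ^+ n) => a.
by let e := constr:([:: x k; y k; a; b]) in ncring h e R.
Qed.

(** The twisted Leibniz rule for E produces [KV b] where [b] is wanted. Modulo y_k, [KV] fixes
    powers of x_k, so the leading coefficient of [KV a] is the image under [KV] of that of [a], and
    [KV] is injective. *)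
Lemma Phi_KV_eq0 n a : isform n a -> (forall m, Phi (KV a) m = 0) ->
  forall m, Phi a m = 0.
Proof.
move=> /isform_normal [c [b [Jc -> _]]].
have [d dE] := KV_xn n.
have -> : KV (x k ^+ n * c + y k * b)
    = x k ^+ n * KV c + y k * (d * KV c + KV b).
  by rewrite (opKVD uP) !(opKVM uP) (opKVy uP) dE mulrDl mulrDr !mulrA addrA.
move=> z m; rewrite Phi_lead //.
have := z 1; rewrite Phi_lead; last exact: Hsub_KV.
move=> /iterK_eq0; rewrite mulr1 => c0.
by rewrite -[c](ma_KVK uMA) c0 (opK0 uP) mul0r -(Phi_xn n) Phi_op0.
Qed.

Hypothesis HI_domain : forall a b : H, a * b = 0 -> a = 0 \/ b = 0.

Lemma gy_mul_eq0 n a : y k ^+ n * a = 0 -> a = 0.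
Proof.
elim: n => [|n IH]; first by rewrite mul1r.
rewrite exprS -mulrA => /HI_domain [/eqP|/IH //].
by rewrite (negPf gy_neq0).
Qed.

(** Here c = h n (n + 1) / 2, but its value is immaterial: the term is a left multiple of y_k beyond
    y_k^n. What counts is the factor n + 1 of x_k, nonzero in characteristic 0. *)
Lemma E_yn n : exists c : K,
  E (y k ^+ n.+1) = y k ^+ n * (n.+1%:R *: x k + c *: y k).
Proof.
elim: n => [|n [c IH]].
  by exists 0; rewrite expr1 (opEy uP) mul1r scale1r scale0r addr0.
exists (c + n.+1%:R * h).
rewrite exprSr (opEM uP) (opKVy uP) IH (opEy uP).
have -> : Kop (y k ^+ n.+1) = y k ^+ n.+1.
  by elim: n.+1 => [|m IHm]; rewrite ?(opK1 uP) // exprS (opKM uP) IHm (opKy uP).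
rewrite exprSr -!mulrA -mulrDr; congr (_ * _).
have -> : n.+2%:R = n.+1%:R + 1 :> K by rewrite -natr1.
rewrite mulrDl -!scalerAl gxy mulrDr -!scalerAr !scalerDl scalerDr scalerA scale1r.
by rewrite -!addrA; congr (_ + _); rewrite addrCA addrA addrC.
Qed.

(* Descent on the degree, dividing by y_k. *)
Lemma form_eq0_desc n m a : isform n a -> E (y k ^+ m * a) = 0 ->
  (forall z, Phi a z = 0) -> a = 0.
Proof.
elim: n m a => [|n IH] m a fa Ea z.
  have [c [b [Jc aE b0]]] := isform_normal fa.
  have := z 1; rewrite aE Phi_lead // mulr1 /= => ->.
  by rewrite b0 !mulr0 addr0.
have [c [b [Jc aE fb]]] := isform_normal fa.
have c0 : c = 0.
  by have := z 1; rewrite aE Phi_lead // mulr1 => /iterK_eq0.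
rewrite aE c0 mulr0 add0r in Ea *.
suff -> : b = 0 by rewrite mulr0.
(* The factor y_k split off from [a] joins the power in front; this is why the induction carries
   [m]. *)
have Eb : E (y k ^+ m.+1 * b) = 0 by rewrite exprSr -mulrA.
apply: (IH _ _ fb Eb); apply: (Phi_KV_eq0 fb) => w.
have [d Ed] := E_yn m.
move: Eb; rewrite (opEM uP) Ed.
have -> : Kop (y k ^+ m.+1) = y k ^+ m.+1.
  by elim: m.+1 => [|i IHi]; rewrite ?(opK1 uP) // exprS (opKM uP) IHi (opKy uP).
(* Cancelling y_k^m leaves ((m + 1) x_k + d y_k) KV(b) + y_k E(b) = 0. Modulo y_k only (m + 1) x_k
   KV(b) survives, so KV(b) acts as zero. *)
rewrite exprSr -!mulrA -mulrDr => /gy_mul_eq0 /(congr1 (Phi ^~ w)).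
rewrite /= Phi0 PhiD mulrDl PhiD !PhiM !PhiZ !Phi_y scaler0 !addr0 Phi_x.
move/eqP; rewrite scaler_eq0 pnatr_eq0 /= => /eqP Kw.
by apply: (@iterK_eq0 1).
Qed.

Lemma form_eq0 n a : isform n a -> E a = 0 -> (forall z, Phi a z = 0) -> a = 0.
Proof. by move=> fa Ea; apply: (@form_eq0_desc n 0); rewrite ?mul1r. Qed.

(** The action on 1 yields c = 0; then y_k is cancelled in the domain H_I. Iterating this peels off
    all coefficients of a form. *)
Lemma lead_indep n c b : Hsub J c -> x k ^+ n * c + y k * b = 0 ->
  c = 0 /\ b = 0.
Proof.
move=> Jc cb0; have c0 : c = 0.
  apply: (@iterK_eq0 n); rewrite -[c]mulr1 -(Phi_lead n b) // cb0.
  exact: Phi0.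
split=> //; apply: (@gy_mul_eq0 1); rewrite expr1 -[LHS]add0r -[RHS]cb0.
by rewrite c0 mulr0.
Qed.

Lemma cubic_indep c0 c1 c2 c3 :
  Hsub J c0 -> Hsub J c1 -> Hsub J c2 -> Hsub J c3 ->
  x k ^+ 3 * c0 + x k ^+ 2 * y k * c1 + x k * y k ^+ 2 * c2 + y k ^+ 3 * c3 = 0 ->
  [/\ c0 = 0, c1 = 0, c2 = 0 & c3 = 0].
Proof.
move=> J0 J1 J2 J3.
(* Nesting with y_k on the left comes from x^2 y = y x^2 + 2h y^2 x + 2h^2 y^3 and x y^2 = y^2 x +
   2h y^3; the system is triangular in the coefficients. *)
have -> : x k ^+ 3 * c0 + x k ^+ 2 * y k * c1 + x k * y k ^+ 2 * c2
    + y k ^+ 3 * c3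
  = x k ^+ 3 * c0 + y k * (x k ^+ 2 * c1 + y k * (x k ^+ 1 * (c2 + (2 * h) *: c1)
    + y k * ((2 * h ^+ 2) *: c1 + (2 * h) *: c2 + c3))).
  have R : x k * y k = y k * x k + h *: (y k * y k) /\ True by rewrite gxy.
  by let e := constr:([:: x k; y k; c0; c1; c2; c3]) in ncring h e R.
case/(lead_indep J0) => -> /(lead_indep J1) [-> ].
rewrite !scaler0 add0r addr0 => /(lead_indep J2) [->].
by rewrite scaler0 add0r.
Qed.

Lemma linear_indep c0 c1 : Hsub J c0 -> Hsub J c1 ->
  x k * c0 + y k * c1 = 0 -> c0 = 0 /\ c1 = 0.
Proof. by rewrite -{1}[x k]expr1 => J0 _; exact: lead_indep. Qed.

End Index.
End Forms.

(** * Polarization *)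

Section Polarization.
Variables (K : numFieldType) (disp : Order.disp_t) (I : orderType disp).
Variables (h : K) (u : Uh_ops (HI I h)).
Hypothesis uP : HI_action u.
Local Notation H := (HI I h).
Local Notation x := (gx (I := I) h).
Local Notation y := (gy (I := I) h).
Local Notation E := (opE u).
Local Notation F := (opF u).
Local Notation Hop := (opH u).
Local Notation Kop := (opK u).
Local Notation KV := (opKV u).

Variables (k l : I) (D : H -> H).
Hypothesis lk : l != k.
Hypothesis DP : polar_derivation k l D.
Local Notation J := [pred i | i != k].

Lemma derD a b : D (a + b) = D a + D b.
Proof. exact: linear_add (pd_lin DP) a b. Qed.
Lemma derZ c a : D (c *: a) = c *: D a.
Proof. exact: linear_scale (pd_lin DP) c a. Qed.
Lemma der0 : D 0 = 0.
Proof. exact: linear_zero (pd_lin DP). Qed.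
Lemma derM a b : D (a * b) = D a * b + a * D b.
Proof. exact: (pd_der DP) a b. Qed.

Lemma der1 : D 1 = 0.
Proof.
have := derM 1 1; rewrite !mulr1 mul1r => /eqP.
by rewrite -subr_eq0 opprD addrA subrr add0r oppr_eq0 => /eqP.
Qed.

Lemma der_gx i : D (x i) = if i == k then x l else 0.
Proof. exact: (pd_x DP). Qed.
Lemma der_gy i : D (y i) = if i == k then y l else 0.
Proof. exact: (pd_y DP). Qed.

Lemma der_coef c : Hsub J c -> D c = 0.
Proof.
elim=> [a [i ik [->|->]]|a|a b _ Da _ Db|a b _ Da _ Db].
- by rewrite der_gx (negPf ik).
- by rewrite der_gy (negPf ik).
- by rewrite derZ der1 scaler0.
- by rewrite derD Da Db addr0.
- by rewrite derM Da Db mul0r mulr0 addr0.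
Qed.

Lemma der_F a : D (F a) = F (D a).
Proof.
elim/HI_ind: a => [c|i|i|a b IHa IHb|a b IHa IHb].
- by rewrite opF1 // derZ der1 scaler0 der0 opF0.
- rewrite (opFx uP) der_gx der_gy.
  by case: ifP; rewrite ?(opFx uP) ?(opF0 uP).
- by rewrite (opFy uP) der0 der_gy; case: ifP; rewrite ?(opFy uP) ?(opF0 uP).
- by rewrite derD !(opFD uP) derD IHa IHb.
- rewrite (opFM uP) derM !derD !derM (opFD uP) !(opFM uP) IHa IHb.
  by rewrite -!addrA; congr (_ + _); rewrite addrCA.
Qed.

Lemma der_K a : D (Kop a) = Kop (D a).
Proof.
elim/HI_ind: a => [c|i|i|a b IHa IHb|a b IHa IHb].
- by rewrite (opKZ uP) (opK1 uP) !derZ der1 scaler0 (opK0 uP).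
- rewrite (opKx uP) derD derZ der_gx der_gy.
  by case: ifP; rewrite ?(opKx uP) // scaler0 addr0 (opK0 uP).
- by rewrite (opKy uP) der_gy; case: ifP; rewrite ?(opKy uP) ?(opK0 uP).
- by rewrite derD !(opKD uP) derD IHa IHb.
- by rewrite (opKM uP) !derM (opKD uP) !(opKM uP) IHa IHb.
Qed.

Lemma der_KV a : D (KV a) = KV (D a).
Proof. by rewrite -{2}[a](ma_KVK (ha_ma uP)) der_K (ma_KK (ha_ma uP)). Qed.

Lemma der_E a : D (E a) = E (D a).
Proof.
elim/HI_ind: a => [c|i|i|a b IHa IHb|a b IHa IHb].
- rewrite (opEZ uP) (ma_E1 (ha_ma uP)) scaler0 der0 derZ der1 scaler0.
  by rewrite (opE0 uP).
- by rewrite (opEx uP) der0 der_gx; case: ifP; rewrite ?(opEx uP) ?(opE0 uP).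
- rewrite (opEy uP) der_gx der_gy.
  by case: ifP; rewrite ?(opEy uP) ?(opE0 uP).
- by rewrite derD !(opED uP) derD IHa IHb.
- rewrite (opEM uP) derM !derD !derM (opED uP) !(opEM uP) IHa IHb der_K der_KV.
  by rewrite -!addrA; congr (_ + _); rewrite addrCA.
Qed.

(** Polarization commutes with E and F: this is visible on generators and survives the Leibniz
    rules. For E it also has to commute with the twists [Kop] and [KV]. *)
Lemma der_invariant a : is_invariant u a -> is_invariant u (D a).
Proof.
case=> Ea Fa _; apply: (invariant_EF uP).
  by rewrite -der_E Ea der0.
by rewrite -der_F Fa der0.
Qed.

(** As l differs from k, the letters x_l, y_l put in place of x_k, y_k are coefficients, so one
    degree is lost. *)
Lemma isform_der n a : isform k n a ->
  if n is n'.+1 then isform k n' (D a) else D a = 0.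
Proof.
elim=> {n a} [c Jc|n a fa IH|n a fa IH|n a b _ IHa _ IHb].
- exact: der_coef.
- rewrite derM der_gx eqxx.
  apply: isform_add; first exact/(isform_cst uP)/fa/Hsub_gx.
  case: n fa IH => [_ ->|n _]; first by rewrite mulr0; exact: isform0.
  exact: isform_x.
- rewrite derM der_gy eqxx.
  apply: isform_add; first exact/(isform_cst uP)/fa/Hsub_gy.
  case: n fa IH => [_ ->|n _]; first by rewrite mulr0; exact: isform0.
  exact: isform_y.
- rewrite derD; case: n IHa IHb => [-> ->|n]; first by rewrite addr0.
  exact: isform_add.
Qed.

Lemma word_cat (v w : seq (I * bool)) : word h (v ++ w) = word h v * word h w.
Proof. by rewrite /word big_cat. Qed.

Lemma homogeneousD m (a b : H) :
  homogeneous k m a -> homogeneous k m b -> homogeneous k m (a + b).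
Proof.
move=> [s [sm ->]] [t [tm ->]]; exists (s ++ t).
by rewrite all_cat sm tm big_cat.
Qed.

Lemma homogeneousM m n (a b : H) :
  homogeneous k m a -> homogeneous k n b -> homogeneous k (m + n) (a * b).
Proof.
move=> [s [/allP sm ->]] [t [/allP tn ->]].
exists [seq (p.1 * q.1, p.2 ++ q.2) | p <- s, q <- t]; split.
  apply/allP => _ /allpairsP[[p q] /= [/sm /eqP pm /tn /eqP qn ->]] /=.
  by rewrite count_cat pm qn.
rewrite big_allpairs_dep mulr_suml; apply: eq_bigr => p _ /=.
rewrite mulr_sumr; apply: eq_bigr => q _ /=.
by rewrite word_cat -scalerAl -scalerAr scalerA.
Qed.

Lemma homogeneous_word (w : seq (I * bool)) :
  homogeneous (h := h) k (count (fun g => g.1 == k) w) (word h w).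
Proof. by exists [:: (1, w)]; rewrite /= eqxx big_seq1 scale1r. Qed.

Lemma homogeneous_gx i : homogeneous (h := h) k (i == k) (x i).
Proof.
have := homogeneous_word [:: (i, true)].
by rewrite /word big_seq1 /= addn0.
Qed.

Lemma homogeneous_gy i : homogeneous (h := h) k (i == k) (y i).
Proof.
have := homogeneous_word [:: (i, false)].
by rewrite /word big_seq1 /= addn0.
Qed.

Lemma homogeneous_coef (c : H) : Hsub J c -> homogeneous k 0 c.
Proof.
elim=> [a [i /= ik [->|->]]|a|a b _ Ha _ Hb|a b _ Ha _ Hb].
- by have := homogeneous_gx i; rewrite (negPf ik).
- by have := homogeneous_gy i; rewrite (negPf ik).
- by exists [:: (a, [::])]; rewrite big_seq1 /word big_nil.
- exact: homogeneousD.
- exact: (homogeneousM Ha Hb).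
Qed.

Lemma isform_homogeneous n (a : H) : isform k n a -> homogeneous k n a.
Proof.
elim=> {n a} [c|n a _ Ha|n a _ Ha|n a b _ Ha _ Hb].
- exact: homogeneous_coef.
- by have := homogeneousM (homogeneous_gx k) Ha; rewrite eqxx.
- by have := homogeneousM (homogeneous_gy k) Ha; rewrite eqxx.
- exact: homogeneousD.
Qed.

(* The endomorphism x_k -> 2 x_k, y_k -> 2 y_k separates the degrees in k. *)
Lemma homogeneous_unique m n (a : H) :
  a != 0 -> homogeneous k m a -> homogeneous k n a -> m = n.
Proof.
pose c i : K := if i == k then 2 else 1.
have rel : HI_relations h (fun i => c i *: x i) (fun i => c i *: y i).
  split=> [i|i j _|i j _|i j _|i j _]; rewrite -!scalerAl -!scalerAr !scalerA.
  - by rewrite gxy scalerDr !scalerA; congr (_ + _ *: _); ring.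
  - by rewrite gxy scalerDr !scalerA; congr (_ *: _ + _ *: _); ring.
  - by rewrite gyx scalerBr !scalerA; congr (_ *: _ - _ *: _); ring.
  - by rewrite gyy; congr (_ *: _); ring.
  - rewrite gxx !scalerDr scalerN !scalerA.
    by congr (_ *: _ - _ *: _ + _ *: _ + _ *: _); ring.
have [phi [phix phiy _]] := HI_universal rel.
have phiE d b : homogeneous k d b -> phi b = 2 ^+ d *: b.
  case=> s [/allP sd ->]; rewrite linear_sum scaler_sumr.
  apply: eq_big_seq => -[e w] /sd /= /eqP <-.
  rewrite linearZ /= scalerA mulrC -scalerA; congr (_ *: _).
  elim: w => [|[i b'] w IH]; first by rewrite /word big_nil rmorph1 scale1r.
  have -> : phi (word h ((i, b') :: w)) = phi (word h [:: (i, b')]) * phi (word h w).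
    by rewrite (word_cat [:: _]) rmorphM.
  have -> : phi (word h [:: (i, b')]) = c i *: word h [:: (i, b')].
    by rewrite /word big_seq1; case: b'; [exact: phix|exact: phiy].
  rewrite (word_cat [:: (i, b')] w) IH -scalerAl -scalerAr scalerA.
  congr (_ *: _); rewrite -[(i, b') :: w]cat1s count_cat /= addn0 exprD /c.
  by case: (i == k); rewrite ?expr1 ?expr0.
move=> a0 /phiE am /phiE; rewrite am => /eqP.
rewrite -subr_eq0 -scalerBl scaler_eq0 (negPf a0) orbF subr_eq0 => /eqP.
rewrite -!natrX => /eqP; rewrite eqr_nat eqn_exp2l //.
exact/eqP.
Qed.

(** The degree picked by [polar] is forced by [homogeneous_unique] when [a] is nonzero; for a = 0
    both sides vanish whatever degree is picked. *)
Lemma polar_form n (a : H) : isform k n.+1 a ->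
  polar k D a = n.+1%:R^-1 *: D a.
Proof.
move=> fa; have [->|a0] := eqVneq a 0; first by rewrite /polar der0 !scaler0.
rewrite /polar; case: xgetP => [m -> /= am|/(_ n.+1) []].
  by rewrite (homogeneous_unique a0 am (isform_homogeneous fa)).
exact: isform_homogeneous.
Qed.

End Polarization.

(** * Invariant cubic forms *)

Section Cubic.
Variables (K : numFieldType) (disp : Order.disp_t) (I : orderType disp).
Variables (h : K) (u : Uh_ops (HI I h)).
Hypothesis uP : HI_action u.
Local Notation H := (HI I h).
Local Notation x := (gx (I := I) h).
Local Notation y := (gy (I := I) h).
Local Notation E := (opE u).
Local Notation F := (opF u).
Local Notation Hop := (opH u).
Local Notation Kop := (opK u).
Local Notation KV := (opKV u).

Hypothesis HI_domain : forall a b : H, a * b = 0 -> a = 0 \/ b = 0.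

Lemma opFX2 a : F (a ^+ 2) = F a * a + a * F a.
Proof. by rewrite expr2 (opFM uP). Qed.
Lemma opFX3 a : F (a ^+ 3) = F a * a ^+ 2 + a * F a * a + a ^+ 2 * F a.
Proof. by rewrite exprS (opFM uP) opFX2 mulrDr expr2 !mulrA addrA. Qed.
Lemma opKX n a : Kop (a ^+ n) = Kop a ^+ n.
Proof.
by elim: n => [|n IH]; rewrite ?expr0 ?(opK1 uP) // !exprS (opKM uP) IH.
Qed.
Lemma opKVX n a : KV (a ^+ n) = KV a ^+ n.
Proof.
by elim: n => [|n IH]; rewrite ?expr0 ?(opKV1 uP) // !exprS (opKVM uP) IH.
Qed.
Lemma opEX2 a : E (a ^+ 2) = E a * KV a + Kop a * E a.
Proof. by rewrite expr2 (opEM uP). Qed.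
Lemma opEX3 a :
  E (a ^+ 3) = E a * KV a ^+ 2 + Kop a * E a * KV a + Kop a ^+ 2 * E a.
Proof.
by rewrite exprS (opEM uP) opEX2 opKVX mulrDr [in RHS]expr2 !mulrA addrA.
Qed.

Definition pushF := (opFD uP, opFN uP, opFZ uP, opFX2, opFX3, opFM uP,
  opFx uP, opFy uP).
Definition pushE := (opED uP, opEN uP, opEZ uP, opEX2, opEX3, opEM uP,
  opEx uP, opEy uP).
Definition pushK := (opKD uP, opKN uP, opKZ uP, opKX, opKM uP, opKx uP,
  opKy uP).
Definition pushKV := (opKVD uP, opKVN uP, opKVZ uP, opKVX, opKVM uP, opKVx uP,
  opKVy uP).

Lemma scale_nat_eq0 n (a : H) : n.+1%:R *: a = 0 -> a = 0.
Proof. by move/eqP; rewrite scaler_eq0 pnatr_eq0 => /eqP. Qed.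

Variables (k : I) (A B C D : H).
Local Notation J := [pred i | i != k].
Hypotheses (JA : Hsub J A) (JB : Hsub J B) (JC : Hsub J C) (JD : Hsub J D).
Hypothesis fI : is_invariant u (cubic (x k) (y k) A B C D).

Ltac Hsub_tac := repeat first
  [ assumption | apply: subalg_genZ | apply: subalg_genN | apply: sg_add
  | apply: subalg_gen0 | apply: subalg_gen1 | apply: subalg_genX
  | apply: sg_mul | apply: (Hsub_F uP) | apply: (Hsub_E uP) ].

(** Coefficients of F f = 0 are compared. For h = 0 this is the contragredient sl(2)-action on the
    coefficients of a binary cubic. *)
Lemma cubic_F : [/\ F A = 0, F B = - A, F C = h *: A - 2 *: B
  & F D = - (3 *: C) + (3 * h) *: B - (2 * h ^+ 2) *: A].
Proof.
have [_ Ff _] := fI.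
have R : y k * x k = x k * y k - h *: (y k * y k) /\ True by rewrite gyx.
have : x k ^+ 3 * F A + x k ^+ 2 * y k * (3 *: (F B + A))
    + x k * y k ^+ 2 * (3 *: (F C - h *: A + 2 *: B))
    + y k ^+ 3 * (F D + 3 *: C - (3 * h) *: B + (2 * h ^+ 2) *: A) = 0.
  rewrite -[RHS]Ff /cubic !pushF.
  by let e := constr:([:: x k; y k; A; B; C; D; F A; F B; F C; F D]) in
     ncring h e R.
case/(cubic_indep uP HI_domain); [by Hsub_tac..|].
move=> -> /scale_nat_eq0 eB /scale_nat_eq0 eC eD; split=> //.
- by apply/eqP; rewrite -subr_eq0 opprK eB.
- by apply/eqP; rewrite -subr_eq0 opprB addrA addrAC eC.
- apply/eqP; rewrite -subr_eq0 -[X in _ == X]eD; apply/eqP.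
  by let e := constr:([:: A; B; C; D; F D]) in ncring h e Logic.I.
Qed.

Let FA : F A = 0. Proof. by case: cubic_F. Qed.
Let FB : F B = - A. Proof. by case: cubic_F. Qed.
Let FC : F C = h *: A - 2 *: B. Proof. by case: cubic_F. Qed.
Let FD : F D = - (3 *: C) + (3 * h) *: B - (2 * h ^+ 2) *: A.
Proof. by case: cubic_F. Qed.
Let KA : Kop A = A. Proof. exact: opK_ker. Qed.
Let KVA : KV A = A. Proof. exact: opKV_ker. Qed.
Let KB : Kop B = B - h *: A.
Proof. by rewrite (opK_ker2 uP) FB ?(opFN uP) ?FA ?oppr0 // scalerN. Qed.
Let KVB : KV B = B + h *: A.
Proof. by rewrite (opKV_ker2 uP) FB ?(opFN uP) ?FA ?oppr0 // scalerN opprK. Qed.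
Let FFC : F (F C) = 2 *: A.
Proof. by rewrite FC !pushF FA FB scaler0 scalerN sub0r opprK. Qed.
Let KC : Kop C = C - (2 * h) *: B + (2 * h ^+ 2) *: A.
Proof.
rewrite (opK_ker4 uP FFC (c := 0)) ?FA ?(opF0 uP) ?scaler0 // FC.
by let e := constr:([:: A; B; C]) in ncring h e Logic.I.
Qed.
Let KVC : KV C = C + (2 * h) *: B.
Proof.
rewrite (opKV_ker4 uP FFC (c := 0)) ?FA ?(opF0 uP) ?scaler0 // FC.
by let e := constr:([:: A; B; C]) in ncring h e Logic.I.
Qed.
Let FFD : F (F D) = 2 *: (3 *: B - (3 * h) *: A).
Proof.
rewrite FD !pushF FA FB FC.
by let e := constr:([:: A; B; C]) in ncring h e Logic.I.
Qed.
Let FFFD : F (3 *: B - (3 * h) *: A) = 3 *: - A.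
Proof. by rewrite !pushF FA FB scaler0 subr0. Qed.
Let KD : Kop D = D - (3 * h) *: C + (6 * h ^+ 2) *: B - (6 * h ^+ 3) *: A.
Proof.
rewrite (opK_ker4 uP FFD FFFD) ?(opFN uP) ?FA ?oppr0 // FD.
by let e := constr:([:: A; B; C; D]) in ncring h e Logic.I.
Qed.
Let KVD : KV D = D + (3 * h) *: C.
Proof.
rewrite (opKV_ker4 uP FFD FFFD) ?(opFN uP) ?FA ?oppr0 // FD.
by let e := constr:([:: A; B; C; D]) in ncring h e Logic.I.
Qed.

Lemma cubic_E : [/\ E A = - (3 * h) *: A - 3 *: B,
  E B = h ^+ 2 *: A - (3 * h) *: B - 2 *: C,
  E C = (6 * h ^+ 2) *: B - D
  & E D = (18 * h ^+ 2) *: C + (6 * h) *: D].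
Proof.
have [Ef _ _] := fI.
have R : y k * x k = x k * y k - h *: (y k * y k) /\ True by rewrite gyx.
(* The twists make the coefficients of E f triangular: each contains the preceding relation as an
   extra term, removed in turn below. *)
have : x k ^+ 3 * (E A + (3 * h) *: A + 3 *: B)
    + x k ^+ 2 * y k * (3 *: (E B - h ^+ 2 *: A + (3 * h) *: B + 2 *: C)
                        + (3 * h) *: (E A + (3 * h) *: A + 3 *: B))
    + x k * y k ^+ 2 * (3 *: (E C - (6 * h ^+ 2) *: B + D)
        + (6 * h) *: (E B - h ^+ 2 *: A + (3 * h) *: B + 2 *: C))
    + y k ^+ 3 * (E D - (18 * h ^+ 2) *: C - (6 * h) *: D
        + (3 * h) *: (E C - (6 * h ^+ 2) *: B + D)) = 0.
  rewrite -[RHS]Ef /cubic !pushE !pushKV !pushK KVA KVB KVC KVD.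
  by let e := constr:([:: x k; y k; A; B; C; D; E A; E B; E C; E D]) in
     ncring h e R.
case/(cubic_indep uP HI_domain); [by Hsub_tac..|].
move=> eA; rewrite eA scaler0 addr0 => /scale_nat_eq0 eB.
rewrite eB scaler0 addr0 => /scale_nat_eq0 eC; rewrite eC scaler0 addr0 => eD.
split; apply/eqP; rewrite -subr_eq0; apply/eqP.
- rewrite -[RHS]eA.
  by let e := constr:([:: A; B; E A]) in ncring h e Logic.I.
- rewrite -[RHS]eB.
  by let e := constr:([:: A; B; C; E B]) in ncring h e Logic.I.
- rewrite -[RHS]eC.
  by let e := constr:([:: A; B; C; D; E C]) in ncring h e Logic.I.
- rewrite -[RHS]eD.
  by let e := constr:([:: A; B; C; D; E D]) in ncring h e Logic.I.
Qed.

Let EA : E A = - (3 * h) *: A - 3 *: B. Proof. by case: cubic_E. Qed.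
Let EB : E B = h ^+ 2 *: A - (3 * h) *: B - 2 *: C.
Proof. by case: cubic_E. Qed.
Let EC : E C = (6 * h ^+ 2) *: B - D. Proof. by case: cubic_E. Qed.
Let ED : E D = (18 * h ^+ 2) *: C + (6 * h) *: D.
Proof. by case: cubic_E. Qed.

(** [c] is sinh(hF) a; the doubled hypothesis avoids the scalar 1/2 in the calculations with
    [ncring]. *)
Lemma opG_eq a b c : Hop a = b - c -> Kop a - KV a = 2 *: c -> opG u a = b.
Proof.
move=> Ha Ka; rewrite /opG Ha Ka scalerA mulVf ?pnatr_eq0 // scale1r.
exact: subrK.
Qed.

Lemma cubic_H : [/\ Hop A = - (3 *: A), Hop B = (2 * h) *: A - B,
  Hop C = - (h ^+ 2 *: A) + (6 * h) *: B + C
  & Hop D = (3 * h ^+ 3) *: A - (3 * h ^+ 2) *: B + (12 * h) *: C + 3 *: D].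
Proof.
split; rewrite -(ma_EF (ha_ma uP)).
- rewrite FA EA !pushF FA FB (opE0 uP).
  by let e := constr:([:: A; B; C; D]) in ncring h e Logic.I.
- rewrite FB EB !(pushF, pushE) FA FB FC EA.
  by let e := constr:([:: A; B; C; D]) in ncring h e Logic.I.
- rewrite FC EC !(pushF, pushE) FB FD EA EB.
  by let e := constr:([:: A; B; C; D]) in ncring h e Logic.I.
- rewrite FD ED !(pushF, pushE) FC FD EA EB EC.
  by let e := constr:([:: A; B; C; D]) in ncring h e Logic.I.
Qed.

Let GA : opG u A = - (3 *: A).
Proof.
have [HA _ _ _] := cubic_H.
by apply: (@opG_eq _ _ 0); rewrite ?HA ?subr0 // KA KVA subrr scaler0.
Qed.
Let GB : opG u B = h *: A - B.
Proof.
have [_ HB _ _] := cubic_H.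
apply: (@opG_eq _ _ (- (h *: A))); rewrite ?HB ?KB ?KVB;
  by let e := constr:([:: A; B; C; D]) in ncring h e Logic.I.
Qed.
Let GC : opG u C = (4 * h) *: B + C.
Proof.
have [_ _ HC _] := cubic_H.
apply: (@opG_eq _ _ (h ^+ 2 *: A - (2 * h) *: B)); rewrite ?HC ?KC ?KVC;
  by let e := constr:([:: A; B; C; D]) in ncring h e Logic.I.
Qed.
Let GD : opG u D = (9 * h) *: C + 3 *: D.
Proof.
have [_ _ _ HD] := cubic_H.
apply: (@opG_eq _ _ ((3 * h ^+ 2) *: B - (3 * h) *: C - (3 * h ^+ 3) *: A));
  rewrite ?HD ?KD ?KVD;
  by let e := constr:([:: A; B; C; D]) in ncring h e Logic.I.
Qed.

(** Instances of [mul_x] and [mul_y]. They hold for every index i, not only for the index k of the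
    form, which lets covariants be evaluated at x_1, y_1 directly. *)
Let coef_rules i :
  A * x i = x i * A - (3 * h) *: (y i * A) /\
  (A * y i = y i * A /\
  (B * x i = x i * (B + h *: A) + h *: (y i * (h *: A - B)) /\
  (B * y i = y i * (B - h *: A) /\
  (C * x i = x i * (C + (2 * h) *: B) + h *: (y i * ((4 * h) *: B + C)) /\
  (C * y i = y i * (C - (2 * h) *: B + (2 * h ^+ 2) *: A) /\
  (D * x i = x i * (D + (3 * h) *: C) + h *: (y i * ((9 * h) *: C + 3 *: D)) /\
  (D * y i = y i * (D - (3 * h) *: C + (6 * h ^+ 2) *: B - (6 * h ^+ 3) *: A)
  /\ True))))))).
Proof.
rewrite !(mul_x uP) !(mul_y uP) GA GB GC GD KA KVA KB KVB KC KVC KD KVD.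
by do !split; rewrite // mulrN scalerN -scalerAr scalerA [h * 3]mulrC.
Qed.

Lemma cubic_comm :
  B * A = A * B - (3 * h) *: (A * A) /\
  (C * A = A * C - (6 * h) *: (A * B) + (12 * h ^+ 2) *: (A * A) /\
  (D * A = A * D - (9 * h) *: (A * C) + (36 * h ^+ 2) *: (A * B)
           - (60 * h ^+ 3) *: (A * A) /\
  (C * B = B * C - (2 * h) *: (B * B) - h *: (A * C) + (2 * h ^+ 2) *: (A * B)
           - (4 * h ^+ 3) *: (A * A) /\
  (D * B = B * D - (3 * h) *: (B * C) + (6 * h ^+ 2) *: (B * B)
           - (3 * h) *: (A * D) + (9 * h ^+ 2) *: (A * C)
           - (24 * h ^+ 3) *: (A * B) + (36 * h ^+ 4) *: (A * A) /\
  (D * C = C * D + (3 * h) *: (C * C) - (6 * h) *: (B * D)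
           - (18 * h ^+ 3) *: (B * B) + (12 * h ^+ 2) *: (A * D)
           - (6 * h ^+ 3) *: (A * C) + (36 * h ^+ 4) *: (A * B)
           - (48 * h ^+ 5) *: (A * A) /\ True))))).
Proof.
have Cf a : a * cubic (x k) (y k) A B C D - cubic (x k) (y k) A B C D * a = 0.
  by rewrite (invariant_central uP fI) subrr.
have R1 := conj (gyx h k k) (coef_rules k).
have [BA [CA DA]] : [/\ B * A = A * B - (3 * h) *: (A * A) ,
  C * A = A * C - (6 * h) *: (A * B) + (12 * h ^+ 2) *: (A * A) &
  D * A = A * D - (9 * h) *: (A * C) + (36 * h ^+ 2) *: (A * B)
           - (60 * h ^+ 3) *: (A * A)].
  have : x k ^+ 3 * 0
    + x k ^+ 2 * y k * (3 *: (A * B - (3 * h) *: (A * A) - B * A))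
    + x k * y k ^+ 2 * (3 *: (A * C - (6 * h) *: (A * B)
        + (12 * h ^+ 2) *: (A * A) - C * A))
    + y k ^+ 3 * (A * D - (9 * h) *: (A * C) + (36 * h ^+ 2) *: (A * B)
           - (60 * h ^+ 3) *: (A * A) - D * A) = 0.
    rewrite -[RHS](Cf A) /cubic.
    by let e := constr:([:: x k; y k; A; B; C; D]) in ncring h e R1.
  case/(cubic_indep uP HI_domain); [by Hsub_tac..|].
  move=> _ /scale_nat_eq0 /eqP e1 /scale_nat_eq0 /eqP e2 /eqP e3.
  by rewrite !subr_eq0 in e1 e2 e3; split; apply/esym/eqP.
(* Each round feeds the next: with the relations just found, the coefficients of x^3 and x^2 y in B
   f - f B vanish identically and the other two are new information. For C only the coefficient of
   y^3 remains. *)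
have R2 := conj BA (conj CA (conj DA R1)).
have [CB DB] : C * B = B * C - (2 * h) *: (B * B) - h *: (A * C)
    + (2 * h ^+ 2) *: (A * B) - (4 * h ^+ 3) *: (A * A) /\
  D * B = B * D - (3 * h) *: (B * C) + (6 * h ^+ 2) *: (B * B)
           - (3 * h) *: (A * D) + (9 * h ^+ 2) *: (A * C)
           - (24 * h ^+ 3) *: (A * B) + (36 * h ^+ 4) *: (A * A).
  have : x k ^+ 3 * 0 + x k ^+ 2 * y k * 0
    + x k * y k ^+ 2 * (3 *: (B * C - (2 * h) *: (B * B) - h *: (A * C)
        + (2 * h ^+ 2) *: (A * B) - (4 * h ^+ 3) *: (A * A) - C * B))
    + y k ^+ 3 * (B * D - (3 * h) *: (B * C) + (6 * h ^+ 2) *: (B * B)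
        - (3 * h) *: (A * D) + (9 * h ^+ 2) *: (A * C)
        - (24 * h ^+ 3) *: (A * B) + (36 * h ^+ 4) *: (A * A) - D * B) = 0.
    rewrite -[RHS](Cf B) /cubic.
    by let e := constr:([:: x k; y k; A; B; C; D]) in ncring h e R2.
  case/(cubic_indep uP HI_domain); [by Hsub_tac..|].
  move=> _ _ /scale_nat_eq0 /eqP e2 /eqP e3.
  by rewrite !subr_eq0 in e2 e3; split; apply/esym/eqP.
have R3 := conj CB (conj DB R2).
do !split=> //.
have : x k ^+ 3 * 0 + x k ^+ 2 * y k * 0 + x k * y k ^+ 2 * 0
    + y k ^+ 3 * (C * D + (3 * h) *: (C * C) - (6 * h) *: (B * D)
           - (18 * h ^+ 3) *: (B * B) + (12 * h ^+ 2) *: (A * D)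
           - (6 * h ^+ 3) *: (A * C) + (36 * h ^+ 4) *: (A * B)
           - (48 * h ^+ 5) *: (A * A) - D * C) = 0.
  rewrite -[RHS](Cf C) /cubic.
  by let e := constr:([:: x k; y k; A; B; C; D]) in ncring h e R3.
case/(cubic_indep uP HI_domain); [by Hsub_tac..|].
by move=> _ _ _ /eqP; rewrite subr_eq0 => /eqP.
Qed.

(** All relations oriented towards words in the order x_i, y_i, A, B, C, D. *)
Definition cubic_rules i := conj (gyx h i i)
  (conj (proj1 cubic_comm) (conj (proj1 (proj2 cubic_comm))
  (conj (proj1 (proj2 (proj2 cubic_comm)))
  (conj (proj1 (proj2 (proj2 (proj2 cubic_comm))))
  (conj (proj1 (proj2 (proj2 (proj2 (proj2 cubic_comm)))))
  (conj (proj1 (proj2 (proj2 (proj2 (proj2 (proj2 cubic_comm))))))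
  (coef_rules i))))))).

(** E and F are known on A, B, C, D and on the generators, so both values are computed; H follows
    from [E, F] = H. Taking i = 1 gives the invariance of the polarized Hessian. *)
Lemma hessian_invariant i : is_invariant u (hessian h (x i) (y i) A B C D).
Proof.
have R := cubic_rules i.
rewrite /hessian; apply/invariantZ=> //.
apply: (invariant_EF uP); rewrite /covK /covL /covM.
  rewrite !(pushE, EA, EB, EC, ED) !(pushKV, KVA, KVB, KVC, KVD).
  rewrite !(pushK, KA, KB, KC, KD).
  by let e := constr:([:: x i; y i; A; B; C; D]) in ncring h e R.
rewrite !(pushF, FA, FB, FC, FD).
by let e := constr:([:: x i; y i; A; B; C; D]) in ncring h e R.
Qed.

Lemma cubic_invariant i : is_invariant u (cubic (x i) (y i) A B C D).
Proof.
have R := cubic_rules i.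
apply: (invariant_EF uP); rewrite /cubic.
  rewrite !(pushE, EA, EB, EC, ED) !(pushKV, KVA, KVB, KVC, KVD).
  rewrite !(pushK, KA, KB, KC, KD).
  by let e := constr:([:: x i; y i; A; B; C; D]) in ncring h e R.
rewrite !(pushF, FA, FB, FC, FD).
by let e := constr:([:: x i; y i; A; B; C; D]) in ncring h e R.
Qed.

(** A seminvariant: being killed by F, it is fixed by [Kop] and may be pulled out of powers of [Kop]
    when leading coefficients are compared. The same holds for [covS] and [polar_lead]. *)
Lemma covK_F : F (covK h A B C D) = 0.
Proof.
rewrite /covK !(pushF, FA, FB, FC, FD).
by let e := constr:([:: x k; y k; A; B; C; D]) in ncring h e (cubic_rules k).
Qed.

Lemma covS_F : F (covS h A B C D) = 0.
Proof.
rewrite /covS !(pushF, FA, FB, FC, FD).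
by let e := constr:([:: x k; y k; A; B; C; D]) in ncring h e (cubic_rules k).
Qed.

(* The first polar of f at x_1, y_1, up to the factor K^2, modulo y_1. *)
Definition polar_lead i := x i * A + y i * B - h *: (y i * A).

Lemma polar_lead_F i : F (polar_lead i) = 0.
Proof.
rewrite /polar_lead !(pushF, FA, FB, FC, FD).
by let e := constr:([:: x i; y i; A; B; C; D]) in ncring h e (cubic_rules i).
Qed.

(* Completing the cube: the noncommutative form of the classical syzygy
   a^2 f = (a x + b y)^3 + 3 H (a x + b y) y^2 + S y^3. *)
Lemma cubic_syzygy i :
  2 *: (cubic (x i) (y i) A B C D * A ^+ 2)
  = 2 *: polar_lead i ^+ 3
    + 3 *: (covK h A B C D * y i ^+ 2 * polar_lead i)
    + 2 *: (covS h A B C D * y i ^+ 3).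
Proof.
rewrite /cubic /polar_lead /covK /covS.
by let e := constr:([:: x i; y i; A; B; C; D]) in ncring h e (cubic_rules i).
Qed.

(** The origin of the explicit gamma and delta: the second polar is sorted into words with x_k, y_k
    in front. The factor 6 = 3 * 2 is undone by the normalization of the polarization. *)
Lemma der2_cubic l DD : polar_derivation k l DD -> l != k ->
  DD (DD (cubic (x k) (y k) A B C D))
  = 6 *: (x k * cardano_delta h (x l) (y l) A B C D
          - y k * cardano_gamma h (x l) (y l) A B C D
          - h *: (y k * cardano_delta h (x l) (y l) A B C D)).
Proof.
move=> DP lk.
have [dA dB dC dD] : [/\ DD A = 0, DD B = 0, DD C = 0 & DD D = 0].
  by split; apply: (der_coef DP).
have [dx dy dx1 dy1] : [/\ DD (x k) = x l, DD (y k) = y l,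
    DD (x l) = 0 & DD (y l) = 0].
  by rewrite !(der_gx DP) !(der_gy DP) eqxx (negPf lk).
rewrite /cubic !expr2 !exprS !expr0 !mulr1.
rewrite !(derD DP, derZ DP, derM DP, dA, dB, dC, dD, dx, dy, dx1, dy1,
  der0 DP, mulr0, mul0r, addr0, add0r).
rewrite /cardano_gamma /cardano_gamma0 /cardano_delta.
have R := conj (gxy h k l) (conj (gyx h k l) (conj (gyy h k l)
  (conj (gxx h k l) (conj (gyx h k k) (conj (gyx h l l)
  (proj2 (cubic_rules l))))))).
by let e := constr:([:: x k; y k; x l; y l; A; B; C; D]) in ncring h e R.
Qed.

End Cubic.

(** * The identity for f f_1^2 *)

Section MainIdentity.
Variables (K : numFieldType) (disp : Order.disp_t) (I : orderType disp).
Variables (h : K) (u : Uh_ops (HI I h)).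
Hypothesis uP : HI_action u.
Local Notation H := (HI I h).
Local Notation x := (gx (I := I) h).
Local Notation y := (gy (I := I) h).
Local Notation E := (opE u).
Local Notation F := (opF u).
Local Notation Kop := (opK u).

Hypothesis HI_domain : forall a b : H, a * b = 0 -> a = 0 \/ b = 0.

Lemma bracket_invariant i j : is_invariant u (bracket h i j).
Proof.
apply: (invariant_EF uP); rewrite /bracket.
  rewrite !(pushE uP) !(pushKV uP) !(pushK uP).
  by let e := constr:([:: x i; y i; x j; y j]) in
     ncring h e (conj (gxy h i j) Logic.I).
rewrite !(pushF uP).
by let e := constr:([:: x i; y i; x j; y j]) in ncring h e Logic.I.
Qed.

Lemma iterK_mul n a m : F a = 0 -> iter n Kop (a * m) = a * iter n Kop m.
Proof.
by move=> Fa; elim: n => //= n ->; rewrite (opKM uP) (opK_ker uP Fa).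
Qed.

Lemma opF_X a p : F a = 0 -> F (a ^+ p) = 0.
Proof.
move=> Fa; elim: p => [|p IH]; first exact: ma_F1 (ha_ma uP).
by rewrite exprS (opFM uP) Fa IH mul0r mulr0 addr0.
Qed.

(** Left multiplication by an element killed by F commutes with [Kop], so leading coefficients
    multiply without twist and the powers of [Kop] collect on one side. *)
Lemma Phi_X k n a b m : F b = 0 -> (forall z, Phi u k a z = iter n Kop (b * z)) ->
  forall p, Phi u k (a ^+ p) m = b ^+ p * iter (n * p) Kop m.
Proof.
move=> Fb ab p; elim: p => [|p IH]; first by rewrite muln0 (Phi1 uP) mul1r.
rewrite exprS (PhiM uP) IH ab mulrA -exprS (iterK_mul _ _ (opF_X _ Fb)).
by rewrite -iterD -mulnS.
Qed.

(** * Binary quadratic and cubic forms: leading coefficients and polars *)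

Section BinaryForms.
Variables (k : I) (a b c d : H).
Local Notation J := [pred i | i != k].
Hypotheses (Ja : Hsub J a) (Jb : Hsub J b) (Jc : Hsub J c) (Jd : Hsub J d).

Lemma isform_mulr n (p q : H) : isform k n p -> Hsub J q -> isform k n (p * q).
Proof. by move=> fp Jq; rewrite -[n]addn0; apply/(isformM uP fp)/isform_coef. Qed.

Lemma isform_cubic : isform k 3
  (x k ^+ 3 * a + x k ^+ 2 * y k * b + x k * y k ^+ 2 * c + y k ^+ 3 * d).
Proof.
have [fx fy] := (isform_gx h k, isform_gy h k).
have fx2 := isformX uP 2 fx; have fy2 := isformX uP 2 fy.
do ![apply: isform_add]; apply: isform_mulr => //.
- exact: (isformX uP 3 fx).
- exact: (isformM uP fx2 fy).
- exact: (isformM uP fx fy2).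
- exact: (isformX uP 3 fy).
Qed.

Lemma isform_quadratic : isform k 2
  (x k ^+ 2 * a + x k * y k * b + y k ^+ 2 * c).
Proof.
have [fx fy] := (isform_gx h k, isform_gy h k).
do ![apply: isform_add]; apply: isform_mulr => //.
- exact: (isformX uP 2 fx).
- exact: (isformM uP fx fy).
- exact: (isformX uP 2 fy).
Qed.

Lemma Phi_cubic m : Phi u k
  (x k ^+ 3 * a + x k ^+ 2 * y k * b + x k * y k ^+ 2 * c + y k ^+ 3 * d) m
  = iter 3 Kop (a * m).
Proof.
rewrite !(PhiD uP) !(PhiM uP) !(Phi_y uP) !(Phi_op0 uP) !addr0.
by rewrite (Phi_coef uP _ Ja) !(Phi_x uP).
Qed.

Lemma Phi_quadratic m : Phi u k
  (x k ^+ 2 * a + x k * y k * b + y k ^+ 2 * c) m = iter 2 Kop (a * m).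
Proof.
rewrite !(PhiD uP) !(PhiM uP) !(Phi_y uP) !(Phi_op0 uP) !addr0.
by rewrite (Phi_coef uP _ Ja) !(Phi_x uP).
Qed.

Variables (l : I) (DD : H -> H).
Hypothesis lk : l != k.
Hypothesis DP : polar_derivation k l DD.

Let ders : [/\ DD (x k) = x l, DD (y k) = y l, DD (x l) = 0 & DD (y l) = 0].
Proof. by rewrite !(der_gx DP) !(der_gy DP) eqxx (negPf lk). Qed.

Lemma der3_cubic : DD (DD (DD
  (x k ^+ 3 * a + x k ^+ 2 * y k * b + x k * y k ^+ 2 * c + y k ^+ 3 * d)))
  = 6 *: (x l ^+ 3 * a + x l ^+ 2 * y l * b + x l * y l ^+ 2 * c + y l ^+ 3 * d).
Proof.
have [dx dy dx1 dy1] := ders; rewrite !expr2 !exprS !expr0 !mulr1.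
rewrite !(derD DP, derZ DP, derM DP, der_coef DP Ja, der_coef DP Jb,
  der_coef DP Jc, der_coef DP Jd, dx, dy, dx1, dy1,
  der0 DP, mulr0, mul0r, addr0, add0r).
by let e := constr:([:: x l; y l; a; b; c; d]) in ncring h e Logic.I.
Qed.

Lemma der2_quadratic : DD (DD (x k ^+ 2 * a + x k * y k * b + y k ^+ 2 * c))
  = 2 *: (x l ^+ 2 * a + x l * y l * b + y l ^+ 2 * c).
Proof.
have [dx dy dx1 dy1] := ders; rewrite !expr2.
rewrite !(derD DP, derZ DP, derM DP, der_coef DP Ja, der_coef DP Jb,
  der_coef DP Jc, dx, dy, dx1, dy1, der0 DP, mulr0, mul0r, addr0, add0r).
by let e := constr:([:: x l; y l; a; b; c]) in ncring h e Logic.I.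
Qed.

(** The degree in k drops at each step, giving the factors 1/3, 1/2 and 1. *)
Lemma iter_polar3 (p : H) : isform k 3 p ->
  iter 3 (polar k DD) p = 6^-1 *: DD (DD (DD p)).
Proof.
move=> f3; have f2 := isform_der uP lk DP f3.
have f1 := isform_der uP lk DP f2.
rewrite /= (polar_form DP f3) (polar_form DP (isformZ uP _ f2)) !(derZ DP).
rewrite (polar_form DP (isformZ uP _ (isformZ uP _ f1))).
by rewrite !(derZ DP) !scalerA; congr (_ *: _); field.
Qed.

Lemma iter_polar2_cubic (p : H) : isform k 3 p ->
  iter 2 (polar k DD) p = 6^-1 *: DD (DD p).
Proof.
move=> f3; have f2 := isform_der uP lk DP f3.
rewrite /= (polar_form DP f3) (polar_form DP (isformZ uP _ f2)) !(derZ DP).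
by rewrite !scalerA; congr (_ *: _); field.
Qed.

Lemma iter_polar2 (p : H) : isform k 2 p -> iter 2 (polar k DD) p = 2^-1 *: DD (DD p).
Proof.
move=> f2; have f1 := isform_der uP lk DP f2.
rewrite /= (polar_form DP f2) (polar_form DP (isformZ uP _ f1)) !(derZ DP).
by rewrite !scalerA; congr (_ *: _); field.
Qed.

End BinaryForms.

Lemma cubicE (X Y a b c d : H) : cubic X Y a b c d
  = X ^+ 3 * a + X ^+ 2 * Y * (3 *: b) + X * Y ^+ 2 * (3 *: c) + Y ^+ 3 * d.
Proof. by rewrite /cubic -!scalerAr. Qed.

Variables (k l : I) (A B C D S1 S2 S3 : H) (DD : H -> H).
Hypothesis lk : l != k.
Hypothesis DP : polar_derivation k l DD.
Local Notation J := [pred i | (i != k) && (i != l)].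
Local Notation Jk := [pred i | i != k].
Local Notation Jl := [pred i | i != l].
Hypotheses (JA : Hsub J A) (JB : Hsub J B) (JC : Hsub J C) (JD : Hsub J D).
Hypotheses (JS1 : Hsub J S1) (JS2 : Hsub J S2) (JS3 : Hsub J S3).
Local Notation f := (cubic (x k) (y k) A B C D).
Local Notation S := (covS h A B C D).
Local Notation j := (x k ^+ 3 * S + x k ^+ 2 * y k * S1 + x k * y k ^+ 2 * S2
  + y k ^+ 3 * S3).
Hypothesis fI : is_invariant u f.
Hypothesis jI : is_invariant u j.

Local Notation f1 := (cubic (x l) (y l) A B C D).
Local Notation delta := (cardano_delta h (x l) (y l) A B C D).
Local Notation gamma := (cardano_gamma h (x l) (y l) A B C D).
Local Notation xi := (x k * delta - y k * gamma - h *: (y k * delta)).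
Local Notation Delta1 := (hessian h (x l) (y l) A B C D).
Local Notation j1 := (x l ^+ 3 * S + x l ^+ 2 * y l * S1 + x l * y l ^+ 2 * S2
  + y l ^+ 3 * S3).
Local Notation eta := (bracket h k l).

Let Hk (a : H) : Hsub J a -> Hsub Jk a.
Proof. by apply: Hsub_sub => i /andP[]. Qed.
Let Hl (a : H) : Hsub J a -> Hsub Jl a.
Proof. by apply: Hsub_sub => i /andP[]. Qed.

Let kl : k != l. Proof. by rewrite eq_sym. Qed.

Ltac Hsub_tac := repeat first
  [ assumption | apply: subalg_genZ | apply: subalg_genN | apply: sg_add
  | apply: subalg_gen0 | apply: subalg_gen1 | apply: subalg_genX
  | apply: sg_mul | by apply: Hsub_gx | by apply: Hsub_gy
  | by apply: Hk | by apply: Hl ].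

Lemma Hsub_covS (P : {pred I}) : Hsub P A -> Hsub P B -> Hsub P C -> Hsub P D ->
  Hsub P S.
Proof. by move=> PA PB PC PD; rewrite /covS; Hsub_tac. Qed.

Lemma Hsub_covK (P : {pred I}) : Hsub P A -> Hsub P B -> Hsub P C -> Hsub P D ->
  [/\ Hsub P (covK h A B C D), Hsub P (covL h A B C D) & Hsub P (covM h A B C D)].
Proof. by move=> PA PB PC PD; rewrite /covK /covL /covM; split; Hsub_tac. Qed.

Lemma Hsub_delta : Hsub Jk delta.
Proof. by rewrite /cardano_delta; Hsub_tac. Qed.

Lemma Hsub_gamma : Hsub Jk gamma.
Proof. by rewrite /cardano_gamma /cardano_gamma0 /cardano_delta; Hsub_tac. Qed.

Lemma isform_f i : Hsub [pred i' | i' != i] A -> Hsub [pred i' | i' != i] B ->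
  Hsub [pred i' | i' != i] C -> Hsub [pred i' | i' != i] D ->
  isform i 3 (cubic (x i) (y i) A B C D).
Proof.
by move=> PA PB PC PD; rewrite cubicE; apply: isform_cubic => //;
  apply: subalg_genZ.
Qed.

Lemma isform_hessian i : Hsub [pred i' | i' != i] A ->
  Hsub [pred i' | i' != i] B ->
  Hsub [pred i' | i' != i] C -> Hsub [pred i' | i' != i] D ->
  isform i 2 (hessian h (x i) (y i) A B C D).
Proof.
move=> PA PB PC PD; rewrite /hessian; apply: (isformZ uP).
by have [? ? ?] := Hsub_covK PA PB PC PD; apply: isform_quadratic.
Qed.

Lemma polar_f : iter 3 (polar k DD) f = f1.
Proof.
rewrite (iter_polar3 lk DP); last by apply: isform_f; Hsub_tac.
rewrite cubicE (der3_cubic _ _ _ _ lk DP); try by Hsub_tac.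
by rewrite scalerA mulVf ?pnatr_eq0 // scale1r -cubicE.
Qed.

Lemma polar_j : iter 3 (polar k DD) j = j1.
Proof.
have JS : Hsub Jk S by apply: Hsub_covS; Hsub_tac.
rewrite (iter_polar3 lk DP); last by apply: isform_cubic; Hsub_tac.
rewrite (der3_cubic _ _ _ _ lk DP); try by Hsub_tac.
by rewrite scalerA mulVf ?pnatr_eq0 // scale1r.
Qed.

Lemma polar_hessian :
  iter 2 (polar k DD) (hessian h (x k) (y k) A B C D) = Delta1.
Proof.
have [JK JL JM] := Hsub_covK (Hk JA) (Hk JB) (Hk JC) (Hk JD).
rewrite (iter_polar2 lk DP); last by apply: isform_hessian; Hsub_tac.
rewrite /hessian !(derZ DP) (der2_quadratic JK JL JM lk DP).
by rewrite !scalerA; congr (_ *: _); field.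
Qed.

Lemma polar_xi : iter 2 (polar k DD) f = xi.
Proof.
rewrite (iter_polar2_cubic lk DP); last by apply: isform_f; Hsub_tac.
rewrite (der2_cubic uP HI_domain (Hk JA) (Hk JB) (Hk JC) (Hk JD) fI DP lk).
by rewrite scalerA mulVf ?pnatr_eq0 // scale1r.
Qed.

Lemma xi_invariant : is_invariant u xi.
Proof.
rewrite -polar_xi (iter_polar2_cubic lk DP); last by apply: isform_f; Hsub_tac.
by apply: invariantZ => //; do 2!apply: (der_invariant uP DP).
Qed.

(** The lower coefficients of j are not explicit, so invariance is inherited from j through
    polarization instead of being computed as for f_1 and the Hessian. *)
Lemma j1_invariant : is_invariant u j1.
Proof.
have JS : Hsub Jk S by apply: Hsub_covS; Hsub_tac.
rewrite -polar_j (iter_polar3 lk DP); last by apply: isform_cubic; Hsub_tac.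
by apply: invariantZ => //; do 3!apply: (der_invariant uP DP).
Qed.

Lemma f1_invariant : is_invariant u f1.
Proof.
exact: (cubic_invariant uP HI_domain (Hk JA) (Hk JB) (Hk JC) (Hk JD) fI).
Qed.

Lemma Delta1_invariant : is_invariant u Delta1.
Proof.
exact: (hessian_invariant uP HI_domain (Hk JA) (Hk JB) (Hk JC) (Hk JD) fI).
Qed.

Let F_tab := cubic_F uP HI_domain (Hk JA) (Hk JB) (Hk JC) (Hk JD) fI.

(** A change of shape only, for the lemmas on binary quadratic forms in x_l, y_l. *)
Lemma delta_quadratic : delta = x l ^+ 2 * A + x l * y l * (2 *: B - h *: A)
  + y l ^+ 2 * (C - h *: B + h ^+ 2 *: A).
Proof. by []. Qed.

Lemma gamma_quadratic : gamma = x l ^+ 2 * (- (B + (2 * h) *: A))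
  + x l * y l * (- (2 *: C + (5 * h) *: B))
  + y l ^+ 2 * (- (D + (3 * h) *: C)).
Proof.
rewrite /cardano_gamma /cardano_gamma0 /cardano_delta.
by let e := constr:([:: x l; y l; A; B; C; D]) in ncring h e Logic.I.
Qed.

(** The roles are exchanged: x_l, y_l are the variables and x_k, y_k count as coefficients. The
    latter stand to the left of x_l^2, and pulling the square of [Kop] in front of them produces
    [polar_lead]. *)
Lemma Phi_xi z : Phi u l xi z = iter 2 Kop (polar_lead A B k * z).
Proof.
have [FA FB _ _] := F_tab.
rewrite delta_quadratic gamma_quadratic.
rewrite !(PhiD uP) !(PhiN uP) (PhiZ uP) !(PhiM uP).
rewrite !Phi_quadratic; try by Hsub_tac.
rewrite (Phi_coef uP _ (Hsub_gx h (_ : k \in Jl))) //.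
rewrite !(Phi_coef uP _ (Hsub_gy h (_ : k \in Jl))) //.
have KA := opK_ker uP FA.
have KB : Kop B = B - h *: A.
  by rewrite (opK_ker2 uP) FB ?(opFN uP) ?FA ?oppr0 // scalerN.
have Fp := polar_lead_F uP HI_domain (Hk JA) (Hk JB) (Hk JC) (Hk JD) fI k.
rewrite !(iterK_mul _ _ FA) (iterK_mul _ _ Fp).
rewrite /= !(opKM uP) !(opKN uP, opKD uP, opKZ uP, KB, KA) /polar_lead.
by let e := constr:([:: x k; y k; A; B; Kop (Kop z)]) in ncring h e Logic.I.
Qed.

(** Only - y_k x_l survives modulo y_l. Its sign turns - j_1 eta^3 into the term + S y^3 of the
    syzygy. *)
Lemma Phi_eta z : Phi u l eta z = iter 1 Kop (- y k * z).
Proof.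
rewrite /bracket !(PhiD uP) !(PhiN uP) (PhiZ uP) !(PhiM uP) Phi_x // Phi_y //.
rewrite !(Phi_op0 uP) (Phi_coef uP _ (Hsub_gy h (_ : k \in Jl))) //.
by rewrite scaler0 sub0r subr0 /= (opKM uP) (opKN uP) (opKy uP) mulNr.
Qed.

Let sextic_form (a b c : H) : isform l 2 a -> isform l 2 b -> isform l 2 c ->
  isform l 6 (a * b * c).
Proof. by move=> fa fb fc; apply: (isformM uP (isformM uP fa fb) fc). Qed.

Lemma xi_form : isform l 2 xi.
Proof.
have fd : isform l 2 delta.
  by rewrite delta_quadratic; apply: isform_quadratic; Hsub_tac.
have fg : isform l 2 gamma.
  by rewrite gamma_quadratic; apply: isform_quadratic; Hsub_tac.
have fx : Hsub Jl (x k) by Hsub_tac.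
have fy : Hsub Jl (y k) by Hsub_tac.
apply: isform_add; last by apply/(isformN uP)/(isformZ uP)/(isform_cst uP).
by apply: isform_add; last apply: (isformN uP); apply: (isform_cst uP).
Qed.

Lemma eta_form : isform l 1 eta.
Proof.
have [fx fy] := (isform_gx h l, isform_gy h l).
have gx : Hsub Jl (x k) by Hsub_tac.
have gy : Hsub Jl (y k) by Hsub_tac.
apply: isform_add; last by apply/(isformN uP)/(isformZ uP)/(isform_cst uP).
by apply: isform_add; last apply: (isformN uP); apply: (isform_cst uP).
Qed.

Theorem cardano_identity :
  f * f1 ^+ 2 = xi ^+ 3 + 3 *: (Delta1 * eta ^+ 2 * xi) - j1 * eta ^+ 3.
Proof.
have [FA _ _ _] := F_tab.
have [xI [eI [jI1 [dI f1I]]]] := (xi_invariant, (bracket_invariant k l,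
  (j1_invariant, (Delta1_invariant, f1_invariant)))).
have [xF eF] := (xi_form, eta_form).
have f1F : isform l 3 f1 by apply: isform_f; Hsub_tac.
have dF : isform l 2 Delta1 by apply: isform_hessian; Hsub_tac.
have jS : Hsub Jl S by apply: Hsub_covS; Hsub_tac.
have jF : isform l 3 j1 by apply: isform_cubic; Hsub_tac.
have fF : Hsub Jl f by rewrite /cubic; Hsub_tac.
have invX n (a : H) : is_invariant u a -> is_invariant u (a ^+ n).
  move=> aI; elim: n => [|n IH]; last by rewrite exprS; apply: (invariantM uP).
  by split; [exact: ma_E1 (ha_ma uP)|exact: ma_F1 (ha_ma uP)|exact: ma_H1 (ha_ma uP)].
have invN (a : H) : is_invariant u a -> is_invariant u (- a).
  by rewrite -scaleN1r; apply: (invariantZ uP).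
apply/eqP; rewrite -subr_eq0; apply/eqP.
(* Degrees are counted in x_l, y_l, so f itself is a coefficient and f_1^2 provides the degree 6. *)
apply: (@form_eq0 _ _ _ _ _ uP l HI_domain 6).
- apply: isform_add; first by apply/(isform_cst uP fF)/(isformX uP 2 f1F).
  apply: (isformN uP); apply: isform_add.
    apply: isform_add; first exact: (isformX uP 3 xF).
    by apply: (isformZ uP); apply: sextic_form => //; exact: (isformX uP 2 eF).
  by apply: (isformN uP); apply: (isformM uP jF (isformX uP 3 eF)).
- suff [] : is_invariant u (f * f1 ^+ 2
    - (xi ^+ 3 + 3 *: (Delta1 * eta ^+ 2 * xi) - j1 * eta ^+ 3)) by [].
  apply: (invariantD uP); first by apply: (invariantM uP fI); exact: (invX _ _).
  apply: (invN _); apply: (invariantD uP).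
    apply: (invariantD uP); first exact: (invX _ _).
    apply: (invariantZ uP); apply: (invariantM uP) => //.
    by apply: (invariantM uP) => //; exact: (invX _ _).
  by apply: (invN _); apply: (invariantM uP) => //; exact: (invX _ _).
move=> z.
have [JK JL JM] := Hsub_covK (Hl JA) (Hl JB) (Hl JC) (Hl JD).
have FK := covK_F uP HI_domain (Hk JA) (Hk JB) (Hk JC) (Hk JD) fI.
have FS := covS_F uP HI_domain (Hk JA) (Hk JB) (Hk JC) (Hk JD) fI.
have Fxi := polar_lead_F uP HI_domain (Hk JA) (Hk JB) (Hk JC) (Hk JD) fI k.
have syz := cubic_syzygy uP HI_domain (Hk JA) (Hk JB) (Hk JC) (Hk JD) fI k.
have Fy : F (- y k) = 0 by rewrite (opFN uP) (opFy uP) oppr0.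
have Pf1 w : Phi u l f1 w = iter 3 Kop (A * w).
  by rewrite cubicE Phi_cubic //; Hsub_tac.
have Pd w : Phi u l Delta1 w = iter 2 Kop (2^-1 *: covK h A B C D * w).
  rewrite (PhiZ uP) Phi_quadratic // -scalerAl /=.
  by rewrite !(opKZ uP).
have Pj w : Phi u l j1 w = iter 3 Kop (S * w) by rewrite Phi_cubic //; Hsub_tac.
have FK2 : F (2^-1 *: covK h A B C D) = 0 by rewrite (opFZ uP) FK scaler0.
have Fy2 := opF_X 2 Fy; have Fy3 := opF_X 3 Fy.
rewrite (PhiD uP) (PhiN uP) !(PhiD uP) (PhiN uP) (PhiZ uP) (PhiM uP _ f).
rewrite (PhiM uP _ (_ * _) xi) (PhiM uP _ Delta1) (PhiM uP _ j1).
rewrite (Phi_coef uP _ fF) (Phi_X _ FA Pf1) Phi_xi.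
rewrite !(Phi_X _ Fxi Phi_xi) !(Phi_X _ Fy Phi_eta) Pd Pj.
rewrite !(iterK_mul _ _ Fxi) !(iterK_mul _ _ FK2) !(iterK_mul _ _ FS).
rewrite !(iterK_mul _ _ Fy2) !(iterK_mul _ _ Fy3) !(iterK_mul _ _ Fxi) -!iterD.
(* The Hessian has leading coefficient K/2. Taking this half as an atom and doubling the goal (the
   argument 1 below means the factor 2) leaves integer coefficients. *)
have KE : covK h A B C D = 2 *: (2^-1 *: covK h A B C D).
  by rewrite scalerA mulfV ?pnatr_eq0 // scale1r.
rewrite {}KE in syz; apply: (@scale_nat_eq0 _ _ _ _ 1).
move: syz; move: f => f'; move: (2^-1 *: covK _ _ _ _ _) => k'.
move: (polar_lead _ _ _) (covS _ _ _ _ _) (iter _ _ _) (y k) => p s w Y syz.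
transitivity ((2 *: (f' * A ^+ 2) - (2 *: p ^+ 3 + 3 *: (2 *: k' * Y ^+ 2 * p)
  + 2 *: (s * Y ^+ 3))) * w); last by rewrite syz subrr mul0r.
by let e := constr:([:: f'; A; p; k'; Y; s; w]) in ncring h e Logic.I.
Qed.

(* The coefficient of x^3 on both sides of the main identity. *)
Lemma lead_identity :
  A * f1 ^+ 2 = delta ^+ 3 + 3 *: (Delta1 * y l ^+ 2 * delta) - j1 * y l ^+ 3.
Proof.
have [FA _ _ _] := F_tab.
have Fd : F delta = 0.
  have R := cubic_rules uP HI_domain (Hk JA) (Hk JB) (Hk JC) (Hk JD) fI l.
  have [_ FB FC FD] := F_tab.
  rewrite /cardano_delta !(pushF uP, FA, FB, FC, FD).
  by let e := constr:([:: x l; y l; A; B; C; D]) in ncring h e R.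
have [_ Ff1 _] := f1_invariant; have [_ FD1 _] := Delta1_invariant.
have [_ Fj1 _] := j1_invariant.
have Jd := Hsub_delta; have Jg := Hsub_gamma.
have Jf1 : Hsub Jk f1 by rewrite /cubic; Hsub_tac.
have JD1 : Hsub Jk Delta1.
  have [JK JL JM] := Hsub_covK (Hk JA) (Hk JB) (Hk JC) (Hk JD).
  by rewrite /hessian; Hsub_tac.
have Jj1 : Hsub Jk j1.
  have JS : Hsub Jk S by apply: Hsub_covS; Hsub_tac.
  by Hsub_tac.
have Px w : Phi u k xi w = iter 1 Kop (delta * w).
  rewrite !(PhiD uP) !(PhiN uP) (PhiZ uP) !(PhiM uP) !(Phi_y uP) (Phi_x uP).
  by rewrite scaler0 !subr0 (Phi_coef uP _ Jd).
have Pe w : Phi u k eta w = iter 1 Kop (y l * w).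
  rewrite /bracket !(PhiD uP) !(PhiN uP) (PhiZ uP) !(PhiM uP) !(Phi_y uP).
  by rewrite (Phi_x uP) scaler0 !subr0 (Phi_coef uP _ (Hsub_gy h _)).
(* Acting on 1 leaves the bare leading coefficients: [Kop] fixes 1, and the coefficients it meets
   are killed by F. *)
have iter1 n : iter n Kop 1 = 1.
  by elim: n => //= n ->; rewrite (opK1 uP).
have Fy := opFy uP l.
have := congr1 (fun t => Phi u k t 1) cardano_identity.
have -> : Phi u k (f * f1 ^+ 2) 1 = A * f1 ^+ 2.
  rewrite (PhiM uP) (Phi_coef uP _ (_ : Hsub Jk (f1 ^+ 2))); last by Hsub_tac.
  rewrite cubicE Phi_cubic; try by Hsub_tac.
  by rewrite mulr1 iterK_mul // -[f1 ^+ 2]mulr1 iterK_mul ?iter1 // opF_X.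
move=> ->; rewrite !(PhiD uP) (PhiN uP) (PhiZ uP).
rewrite (PhiM uP _ (_ * _) xi) (PhiM uP _ Delta1) (PhiM uP _ j1).
rewrite (Phi_coef uP _ JD1) (Phi_coef uP _ Jj1).
rewrite !(Phi_X _ Fd Px) !(Phi_X _ Fy Pe) Px !(iterK_mul _ _ Fd).
by rewrite !iter1 !mulr1 !mulrA.
Qed.

Lemma f_eq0 : A = 0 -> f = 0.
Proof.
move=> A0; have [Ef _ _] := fI.
apply: (form_eq0 uP HI_domain (isform_f _ _ _ _) Ef); try by Hsub_tac.
move=> z; rewrite cubicE Phi_cubic; try by Hsub_tac.
by rewrite A0 mul0r /= !(opK0 uP).
Qed.

(** Independence in x_l, y_l gives A = 0, and then [f_eq0] applies to the invariant f. *)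
Lemma f1_eq0 : f1 = 0 -> f = 0.
Proof.
move=> f10; apply: f_eq0; move: f10; rewrite cubicE.
by case/(cubic_indep uP HI_domain); try by Hsub_tac.
Qed.

(** The total coefficient of y_k is - gamma - h delta. Since it is determined by xi, as delta is,
    the correction by - h delta in [cardano_gamma] is forced. *)
Lemma xi_unique gamma' delta' : Hsub Jk gamma' -> Hsub Jk delta' ->
  xi = x k * delta' - y k * gamma' - h *: (y k * delta') ->
  gamma' = gamma /\ delta' = delta.
Proof.
move=> Jg Jd /eqP; rewrite -subr_eq0 => /eqP e.
have : x k * (delta - delta') + y k * (gamma' - gamma - h *: (delta - delta')) = 0.
  rewrite -[RHS]e; move: gamma delta => g d.
  by let e := constr:([:: x k; y k; d; g; delta'; gamma']) in
     ncring h e Logic.I.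
have Jg0 := Hsub_gamma; have Jd0 := Hsub_delta.
case/(linear_indep uP HI_domain); try by Hsub_tac.
move=> d0; rewrite d0 scaler0 subr0 => /eqP; rewrite subr_eq0 => /eqP ->.
by split=> //; apply/esym/eqP; rewrite -subr_eq0 d0.
Qed.

End MainIdentity.

(** * The factorization *)

Lemma cube_root_unity (K : comPzRingType) (e : K) :
  e ^+ 2 + e + 1 = 0 -> e ^+ 3 = 1.
Proof.
move=> e0; apply/eqP; rewrite -subr_eq0; apply/eqP.
have -> : e ^+ 3 - 1 = (e - 1) * (e ^+ 2 + e + 1) by ring.
by rewrite e0 mulr0.
Qed.

Section Factorization.
Variables (K : comNzRingType) (L : algType K).

(** The classical factorization of p^3 + q^3 + r^3 - 3pqr for p = xi, q = - u_1 eta, r = - u_2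
    eta. *)
Lemma cubic_factor (e : K) (xi eta u1 u2 : L) :
  e ^+ 2 + e + 1 = 0 -> is_central u1 -> is_central u2 -> eta * xi = xi * eta ->
  xi ^+ 3 - 3 *: (u1 * u2 * eta ^+ 2 * xi) - (u1 ^+ 3 + u2 ^+ 3) * eta ^+ 3
  = (xi - (u1 + u2) * eta) * (xi - (e *: u1 + e ^+ 2 *: u2) * eta)
    * (xi - (e ^+ 2 *: u1 + e *: u2) * eta).
Proof.
move=> e0 u1C u2C ex.
have e2 : e ^+ 2 = - e - 1.
  by apply/eqP; rewrite -opprD -addr_eq0 addrA; apply/eqP.
(* The scalar parameter of [ncring] is free; to exploit e^2 + e + 1 = 0 it becomes a central letter
   with a rewriting rule. *)
pose E : L := e%:A.
have EE : E * E = - E - 1.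
  by rewrite /E -scalerAl mul1r scalerA -expr2 e2 scalerBl scaleNr scale1r.
have EC a : a * E = E * a by rewrite /E -scalerAl -scalerAr mul1r mulr1.
rewrite e2 -[e *: u1]mulr_algl -[e *: u2]mulr_algl !scalerBl !scaleNr !scale1r.
rewrite -[e *: u1]mulr_algl -[e *: u2]mulr_algl -/E.
have R := conj EE (conj (EC u1) (conj (EC u2) (conj (EC xi) (conj (EC eta)
  (conj (u2C u1) (conj (esym (u1C xi)) (conj (esym (u2C xi))
  (conj (esym (u1C eta)) (conj (esym (u2C eta)) (conj ex Logic.I)))))))))).
by let a := constr:([:: E; u1; u2; xi; eta]) in ncring e a R.
Qed.

(** Cardano's identity for v_1 + v_2, with v_1 v_2 = e^3 u_1 u_2. Only e^3 = 1 is assumed, so e = 1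
    is covered. *)
Lemma cubic_root (e : K) (u1 u2 v1 v2 : L) : u1 * u2 = u2 * u1 ->
  e ^+ 3 = 1 -> v1 = e *: u1 -> v2 = e ^+ 2 *: u2 ->
  (v1 + v2) ^+ 3 = u1 ^+ 3 + u2 ^+ 3 + 3 *: (u1 * u2 * (v1 + v2)).
Proof.
move=> uC e3 -> ->.
have e6 : (e ^+ 2) ^+ 3 = 1 by rewrite exprAC e3 expr1n.
transitivity (e ^+ 3 *: u1 ^+ 3 + (e ^+ 2) ^+ 3 *: u2 ^+ 3
  + 3 *: (u1 * u2 * (e ^+ 3 *: (e *: u1 + e ^+ 2 *: u2))));
  last by rewrite e3 e6 !scale1r.
by let a := constr:([:: u1; u2]) in ncring e a (conj (esym uC) Logic.I).
Qed.

End Factorization.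

Lemma lrmorph_cubic (K : comNzRingType) (A B : algType K)
  (phi : {lrmorphism A -> B}) a b c d :
  phi (a ^+ 3 + 3 *: (b * c ^+ 2 * a) - d * c ^+ 3)
  = phi a ^+ 3 + 3 *: (phi b * phi c ^+ 2 * phi a) - phi d * phi c ^+ 3.
Proof. by rewrite linearB linearD linearZ /= !rmorphM. Qed.

Lemma lrmorph_linear_form (K : comNzRingType) (A B : algType K)
  (phi : {lrmorphism A -> B}) (h : K) a b c d :
  phi (a * d - b * c - h *: (b * d))
  = phi a * phi d - phi b * phi c - h *: (phi b * phi d).
Proof. by rewrite !linearB linearZ /= !rmorphM. Qed.

Lemma division_rmorph_eq0 (Q L : unitRingType) (kappa : {rmorphism Q -> L}) q :
  division_ring Q -> kappa q = 0 -> q = 0.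
Proof.
move=> Qdiv k0; apply/eqP; apply: contraT => /Qdiv /(rmorph_unit kappa).
by rewrite k0 unitr0.
Qed.

Lemma division_ring_domain (Q : unitRingType) (a b : Q) :
  division_ring Q -> a * b = 0 -> a = 0 \/ b = 0.
Proof.
move=> Qdiv ab; have [->|/Qdiv ua] := eqVneq a 0; first by left.
by right; rewrite -[b]mul1r -(mulVr ua) -mulrA ab mulr0.
Qed.

(** The Leibniz rules on a b = 1 leave a times E b, F b, H b equal to 0. That [opK] fixes [a] is a
    separate hypothesis because in a general module algebra [opK] is not given as an exponential of
    F. *)
Lemma invariantV (K : fieldType) (h : K) (A : algType K) (u : Uh_ops A) a b :
  Uh_module_algebra h u -> is_invariant u a -> opK u a = a ->
  a * b = 1 -> b * a = 1 -> is_invariant u b.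
Proof.
move=> uM [Ea Fa Ha] Ka ab ba.
have cancel c : a * c = 0 -> c = 0 by move=> ac; rewrite -[c]mul1r -ba -mulrA ac mulr0.
split; apply: cancel.
- by have := ma_EM uM a b; rewrite ab (ma_E1 uM) Ea Ka mul0r add0r => <-.
- by have := ma_FM uM a b; rewrite ab (ma_F1 uM) Fa mul0r add0r => <-.
- by have := ma_HM uM a b; rewrite ab (ma_H1 uM) Ha Ka mul0r add0r => <-.
Qed.

(** * Factorization over the extension by radicals *)

Section Extension.
Variables (K : numFieldType) (disp : Order.disp_t) (I : orderType disp).
Variables (h : K) (u : Uh_ops (HI I h)).
Hypothesis uP : HI_action u.
Local Notation H := (HI I h).
Local Notation x := (gx (I := I) h).
Local Notation y := (gy (I := I) h).

Variables (Q : unitAlgType K) (iota : {lrmorphism H -> Q}).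
Hypothesis iotaP : right_quotient_division_ring iota.
Variables (uQ : Uh_ops Q).
Hypothesis uQP : action_extends h iota u uQ.

Lemma HI_domain_of_quotient (a b : H) : a * b = 0 -> a = 0 \/ b = 0.
Proof.
have i0 c : iota c = 0 -> c = 0 by rewrite -(rmorph0 iota) => /(rq_inj iotaP).
move/(congr1 iota); rewrite rmorphM rmorph0.
by case/(division_ring_domain (rq_div iotaP)) => /i0; [left|right].
Qed.
Let HD := HI_domain_of_quotient.

Variables (k l : I) (A B C D S1 S2 S3 : H) (DD : H -> H).
Hypothesis lk : l != k.
Hypothesis DP : polar_derivation k l DD.
Local Notation J := [pred i | (i != k) && (i != l)].
Local Notation Jk := [pred i | i != k].
Hypotheses (JA : Hsub J A) (JB : Hsub J B) (JC : Hsub J C) (JD : Hsub J D).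
Hypotheses (JS1 : Hsub J S1) (JS2 : Hsub J S2) (JS3 : Hsub J S3).
Local Notation f := (cubic (x k) (y k) A B C D).
Local Notation S := (covS h A B C D).
Local Notation j := (x k ^+ 3 * S + x k ^+ 2 * y k * S1 + x k * y k ^+ 2 * S2
  + y k ^+ 3 * S3).
Hypothesis fI : is_invariant u f.
Hypothesis f0 : f <> 0.
Hypothesis jI : is_invariant u j.

Local Notation f1 := (cubic (x l) (y l) A B C D).
Local Notation delta := (cardano_delta h (x l) (y l) A B C D).
Local Notation gamma := (cardano_gamma h (x l) (y l) A B C D).
Local Notation xi := (x k * delta - y k * gamma - h *: (y k * delta)).
Local Notation Delta1 := (hessian h (x l) (y l) A B C D).
Local Notation j1 := (x l ^+ 3 * S + x l ^+ 2 * y l * S1 + x l * y l ^+ 2 * S2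
  + y l ^+ 3 * S3).
Local Notation eta := (bracket h k l).

Variables (L : unitAlgType K) (kappa : {lrmorphism Q -> L}) (s u1 u2 : L).
Hypothesis ext : cardano_extension kappa (iota (discriminant h A B C D))
  (iota f1) (iota j1) (iota Delta1) s u1 u2.
Local Notation inL a := (kappa (iota a)).
Local Notation L0 := (Lsub iota kappa s u1 u2 Jk).

Let idI := cardano_identity uP HD lk DP JA JB JC JD JS1 JS2 JS3 fI jI.
Let xiI := xi_invariant uP HD lk DP JA JB JC JD fI.
Let etaI := bracket_invariant uP k l.
Let f1I := f1_invariant uP HD JA JB JC JD fI.

Let cube_sum : u1 ^+ 3 + u2 ^+ 3 = inL j1.
Proof.
rewrite (ce_cube1 ext) (ce_cube2 ext) -scalerDr addrACA subrr addr0.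
by rewrite -mulr2n -scaler_nat scalerA mulVf ?pnatr_eq0 // scale1r.
Qed.

Let f1_neq0 : f1 ^+ 2 != 0.
Proof.
apply/eqP; rewrite expr2 => ff; apply: f0.
by case: (HD ff) => e; apply: (f1_eq0 uP HD JA JB JC JD fI e).
Qed.

Let iota_unit a : a != 0 -> iota a \is a GRing.unit.
Proof.
move=> a0; apply: (rq_div iotaP); apply: contraNneq a0 => ia0.
by apply/eqP/(rq_inj iotaP); rewrite ia0 rmorph0.
Qed.

Let inL_eq0 a : inL a = 0 -> a = 0.
Proof.
move/(division_rmorph_eq0 (rq_div iotaP)); rewrite -(rmorph0 iota).
exact: (rq_inj iotaP).
Qed.

Lemma factorization (e : K) : e ^+ 2 + e + 1 = 0 ->
  exists C0 : Q, [/\ Qsub iota Jk C0, is_invariant uQ C0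
    & inL f = kappa C0 * (inL xi - (u1 + u2) * inL eta)
        * (inL xi - (e *: u1 + e ^+ 2 *: u2) * inL eta)
        * (inL xi - (e ^+ 2 *: u1 + e *: u2) * inL eta)].
Proof.
move=> e0; have Uf := iota_unit f1_neq0.
have Jf1 : Hsub Jk (f1 ^+ 2).
  have [Jx Jy] := (Hsub_gx h (lk : l \in Jk), Hsub_gy h (lk : l \in Jk)).
  have Jsub (a : H) : Hsub J a -> Hsub Jk a by apply: Hsub_sub => i /andP[].
  by apply: subalg_genX; rewrite /cubic; do !first
    [ apply: sg_add | apply: sg_mul | apply: subalg_genX | apply: subalg_genZ
    | assumption | exact: Jsub ].
exists (iota (f1 ^+ 2))^-1; split.
- exists 1, (f1 ^+ 2); split=> //; first exact: subalg_gen1.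
  by rewrite rmorph1 mul1r.
- have f2I : is_invariant u (f1 ^+ 2) by rewrite expr2; apply: (invariantM uP).
  have [Ef Ff Hf] := f2I.
  apply: (invariantV (ext_ma uQP) _ _ (mulrV Uf) (mulVr Uf)).
    by split; rewrite ?(ext_E uQP) ?(ext_F uQP) ?(ext_H uQP) ?Ef ?Ff ?Hf rmorph0.
  by rewrite (ext_K uQP) (invariant_K uP f2I).
rewrite -!mulrA [X in _ = _ * X]mulrA -cubic_factor //;
  [|exact: (ce_u1 ext)|exact: (ce_u2 ext)|]; last first.
  by rewrite -!rmorphM (invariant_central uP etaI).
have -> : inL xi ^+ 3 - 3 *: (u1 * u2 * inL eta ^+ 2 * inL xi)
    - (u1 ^+ 3 + u2 ^+ 3) * inL eta ^+ 3 = inL (f1 ^+ 2 * f).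
  rewrite -(invariant_central uP fI) idI cube_sum (ce_prod ext).
  by rewrite !mulNr scalerN opprK !lrmorph_cubic.
by rewrite -rmorphM [iota (_ * f)]rmorphM mulKr.
Qed.

(** A vanishing factor would annihilate f. Exponents are reduced modulo 3, so nu = 3 is the factor
    with root u_1 + u_2. *)
Lemma factor_neq0 (e : K) nu : e ^+ 2 + e + 1 = 0 -> nu \in [:: 1; 2; 3]%N ->
  inL xi - (e ^+ nu *: u1 + e ^+ (2 * nu) *: u2) * inL eta != 0.
Proof.
move=> e0 nu3; have [C0 [_ _ fE]] := factorization e0.
have e3 := cube_root_unity e0.
apply/eqP=> fnu; apply: f0; apply: inL_eq0; rewrite fE; move: nu3 fnu.
rewrite !inE => /or3P[] /eqP -> ; rewrite ?e3 ?expr1 /=.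
- by move=> ->; rewrite mulr0 mul0r.
- by rewrite (exprD e 3 1) e3 mul1r => ->; rewrite mulr0.
- by rewrite (exprD e 3 3) e3 mul1r !scale1r => ->; rewrite mulr0 !mul0r.
Qed.

(** * A single linear factor, for an arbitrary cube root of unity e *)

Variables e e' : K.
Hypotheses (e3 : e ^+ 3 = 1) (ee : e' = e ^+ 2).
Local Notation root := (e *: u1 + e' *: u2).

Let root_central : is_central root.
Proof.
move=> b; rewrite mulrDl mulrDr -!scalerAl -!scalerAr.
by rewrite (ce_u1 ext b) (ce_u2 ext b).
Qed.

Lemma factor_linear : inL xi - root * inL eta
  = inL (x k) * (inL delta - root * inL (y l))
    - inL (y k) * (inL gamma - root * inL (x l))
    - h *: (inL (y k) * (inL delta - root * inL (y l))).
Proof.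
rewrite /bracket !lrmorph_linear_form.
move: root root_central => r rC.
have R := conj (esym (rC (inL (x k)))) (conj (esym (rC (inL (y k)))) Logic.I).
move: (inL (x k)) (inL (y k)) (inL (x l)) (inL (y l)) (inL gamma) (inL delta) R.
move=> X Y X1 Y1 g d R.
by let a := constr:([:: r; X; Y; X1; Y1; g; d]) in ncring h a R.
Qed.

Lemma denominator_neq0 : inL delta - root * inL (y l) != 0.
Proof.
apply/eqP=> /eqP; rewrite subr_eq0 => /eqP dE; apply: f0.
have := lead_identity uP HD lk DP JA JB JC JD JS1 JS2 JS3 fI jI.
move/(congr1 (fun a => inL a)).
(* Each root solves r^3 + 3 Delta_1 r - j_1 = 0. With delta = r y_1 the right side of
   [lead_identity] is this expression times y_1^3, hence zero. *)
have r3 : root ^+ 3 = inL j1 - 3 *: (inL Delta1 * root).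
  rewrite ee (cubic_root _ e3 (erefl _) (erefl _)); last exact: (ce_u1 ext).
  by rewrite -ee cube_sum (ce_prod ext) mulNr scalerN.
rewrite !lrmorph_cubic dE.
move: (root) root_central r3 => r rC r3.
have -> : (r * inL (y l)) ^+ 3 + 3 *: (inL Delta1 * inL (y l) ^+ 2 * (r * inL (y l)))
    - inL j1 * inL (y l) ^+ 3
    = (r ^+ 3 + 3 *: (inL Delta1 * r) - inL j1) * inL (y l) ^+ 3.
  have R := conj (esym (rC (inL (y l)))) (conj (esym (rC (inL Delta1))) Logic.I).
  move: (inL (y l)) (inL Delta1) (inL j1) R => Y d j' R.
  by let a := constr:([:: r; Y; d; j']) in ncring h a R.
rewrite r3 subrK subrr mul0r => /inL_eq0 /HD [A0|/eqP]; last by rewrite (negPf f1_neq0).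
exact: (f_eq0 uP HD JA JB JC JD fI A0).
Qed.

Let Hk (a : H) : Hsub J a -> Hsub Jk a.
Proof. by apply: Hsub_sub => i /andP[]. Qed.

Let Lsub_inL a : Hsub Jk a -> L0 (inL a).
Proof.
move=> Ja; apply: dg_gen; left; exists (iota a) => //; exists a, 1.
split=> //; [exact: subalg_gen1|exact: oner_neq0|].
by rewrite rmorph1 divr1.
Qed.

Let Lsub_root : L0 root.
Proof.
rewrite -[e *: u1]mulr_algl -[e' *: u2]mulr_algl.
apply: dg_add; apply: dg_mul; try exact: dg_cst; apply: dg_gen; right.
  by constructor 2.
by constructor 3.
Qed.

Let Lsub_num a b : Hsub Jk a -> Hsub Jk b -> L0 (inL a - root * inL b).
Proof.
move=> Ja Jb; apply: dg_add; first exact: Lsub_inL.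
rewrite -mulN1r; apply: dg_mul; first by rewrite -scaleN1r; exact: dg_cst.
by apply: dg_mul => //; exact: Lsub_inL.
Qed.

Let Jx : Hsub Jk (x l). Proof. exact: Hsub_gx. Qed.
Let Jy : Hsub Jk (y l). Proof. exact: Hsub_gy. Qed.
Let Jdelta := Hsub_delta D lk JA JB JC.
Let Jgamma := Hsub_gamma lk JA JB JC JD.

Lemma factor_form uL : cardano_action h kappa uQ uL s u1 u2 ->
  inL xi - root * inL eta != 0 ->
  nform uL L0 (inL (x k)) (inL (y k)) 1 (inL xi - root * inL eta).
Proof.
move=> [uLP tI] nz; split=> //.
  have inv a : is_invariant u a -> is_invariant uL (inL a).
    case=> Ea Fa Ha; split.
    - by rewrite (ext_E uLP) (ext_E uQP) Ea !rmorph0.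
    - by rewrite (ext_F uLP) (ext_F uQP) Fa !rmorph0.
    - by rewrite (ext_H uLP) (ext_H uQP) Ha !rmorph0.
  have M := ext_ma uLP.
  have [|[E1 F1 H1] _] := tI u1; first by rewrite !inE eqxx orbT.
  have [|[E2 F2 H2] _] := tI u2; first by rewrite !inE eqxx !orbT.
  have [[Ex Fx Hx] [Ee Fe He]] := (inv _ xiI, inv _ etaI).
  have add := linear_add; have sc := linear_scale; have op := linear_opp.
  split.
  - rewrite (add _ _ _ (ma_linE M)) Ex (op _ _ _ (ma_linE M)) (ma_EM M) Ee.
    rewrite (add _ _ _ (ma_linE M)) !(sc _ _ _ (ma_linE M)) E1 E2.
    by rewrite !scaler0 addr0 mul0r mulr0 addr0 oppr0 addr0.
  - rewrite (add _ _ _ (ma_linF M)) Fx (op _ _ _ (ma_linF M)) (ma_FM M) Fe.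
    rewrite (add _ _ _ (ma_linF M)) !(sc _ _ _ (ma_linF M)) F1 F2.
    by rewrite !scaler0 addr0 mul0r mulr0 addr0 oppr0 addr0.
  - rewrite (add _ _ _ (ma_linH M)) Hx (op _ _ _ (ma_linH M)) (ma_HM M) He.
    rewrite (add _ _ _ (ma_linH M)) !(sc _ _ _ (ma_linH M)) H1 H2.
    by rewrite !scaler0 addr0 mul0r mulr0 addr0 oppr0 addr0.
pose Y := inL delta - root * inL (y l).
pose X := inL gamma - root * inL (x l).
have LY : L0 Y by apply: Lsub_num.
have LX : L0 X by apply: Lsub_num.
(* A 1-form is x c_0 + y c_1, so the term - h y Y joins the coefficient of y. *)
exists (fun i => if i is 0 then Y else - X - h *: Y); split.
  have LN a : L0 a -> forall c, L0 (c *: a).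
    by move=> La c; rewrite -mulr_algl; apply: dg_mul => //; exact: dg_cst.
  case=> [|_] //; apply: dg_add; rewrite -scaleN1r; apply: (LN _) => //.
  exact: (LN _).
rewrite big_ord_recl big_ord1 /= !scale1r !mul1r !mulr1 factor_linear -/X -/Y.
by let a := constr:([:: inL (x k); inL (y k); X; Y]) in ncring h a Logic.I.
Qed.

Lemma factor_coordinate :
  projective_coordinate h L0 (inL (x k)) (inL (y k)) (inL xi - root * inL eta)
    ((inL gamma - root * inL (x l)) / (inL delta - root * inL (y l))
     + (h / 2)%:A).
Proof.
exists (inL gamma - root * inL (x l)), (inL delta - root * inL (y l)).
split=> //; [exact: Lsub_num|exact: Lsub_num|exact: denominator_neq0|].
exact: factor_linear.
Qed.

End Extension.

(** Triple angle formulas at t = 2 pi / 3: sin 3t = 0 and sin t > 0 give 4 cos^2 t = 1, hence 4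
    sin^2 t = 3, and cos 3t = 1 then fixes cos t = -1/2. *)
Lemma cbrt_unity (R : realType) :
  let eps : R[i] := (cos (2 * pi / 3) +i* sin (2 * pi / 3))%C in
  eps ^+ 2 + eps + 1 = 0.
Proof.
move=> eps; rewrite /eps; set t : R := 2 * pi / 3.
have t3 : t + t + t = pi *+ 2 by rewrite -mulr_natl /t; field.
have s0 : 0 < sin t.
  by apply: sin_gt0_pi; have := pi_gt0 R; rewrite /t => p; apply/andP; split; lra.
have cs := cos2Dsin2 t.
have := cos2pi R; have := sin2pi R; rewrite -t3 !(sinD, cosD) => es ec.
have cc : 4 * cos t ^+ 2 = 1.
  have : sin t * (4 * cos t ^+ 2 - (cos t ^+ 2 + sin t ^+ 2)) = 0.
    by rewrite -[RHS]es; ring.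
  by move/eqP; rewrite cs mulf_eq0 gt_eqF //= subr_eq0 => /eqP.
have ss : 4 * sin t ^+ 2 = 3 by lra.
have ct : cos t = - 2^-1.
  have : cos t * (4 * cos t ^+ 2) - 3 * cos t * (4 * sin t ^+ 2) = 4.
    by apply: (etrans _ (etrans (congr1 ( *%R 4) ec) (mulr1 _))); ring.
  by rewrite cc ss; lra.
rewrite expr2; apply/eqP; rewrite eq_complex /= !ct; apply/andP; split.
  by apply/eqP; move: ss; rewrite expr2; lra.
by apply/eqP; field.
Qed.

Theorem mainTheorem4
  (R : realType) (h : R[i]) (h_neq0 : h != 0)
  (disp : Order.disp_t) (I : orderType disp) (i0 i1 : I) (i01 : i0 != i1)
  (uH : Uh_ops (HI I h)) (uHP : HI_action uH)
  (Q : unitAlgType R[i]) (iota : {lrmorphism HI I h -> Q})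
  (iotaP : right_quotient_division_ring iota)
  (uQ : Uh_ops Q) (uQP : action_extends h iota uH uQ)
  (D01 : HI I h -> HI I h) (D01P : polar_derivation i0 i1 D01)
  (A B C D f j : HI I h) :
  let x := gx h i0 in
  let y := gy h i0 in
  let x1 := gx h i1 in
  let y1 := gy h i1 in
  let J0 := [pred i : I | i != i0] in
  let J01 := [pred i : I | (i != i0) && (i != i1)] in
  Hsub J01 A -> Hsub J01 B -> Hsub J01 C -> Hsub J01 D ->
  f = cubic x y A B C D ->
  nform uH (Hsub J0) x y 3 f ->
  cubic_covariant h uH x y A B C D j ->
  let P01 := polar i0 D01 in
  let d3 := discriminant h A B C D in
  let f1 := iter 3 P01 f in
  let Delta1 := iter 2 P01 (hessian h x y A B C D) in
  let j1 := iter 3 P01 j in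
  let xi := iter 2 P01 f in
  let eta := bracket h i0 i1 in
  let eps : R[i] := (cos (2 * pi / 3) +i* sin (2 * pi / 3))%C in
  let delta := cardano_delta h x1 y1 A B C D in
  let gamma := cardano_gamma h x1 y1 A B C D in
  [/\ f * f1 ^+ 2 = xi ^+ 3 + 3 *: (Delta1 * eta ^+ 2 * xi) - j1 * eta ^+ 3,

      [/\ Hsub J0 gamma, Hsub J0 delta,
          xi = x * delta - y * gamma - h *: (y * delta)
        & forall gamma' delta', Hsub J0 gamma' -> Hsub J0 delta' ->
            xi = x * delta' - y * gamma' - h *: (y * delta') ->
            gamma' = gamma /\ delta' = delta]

    & forall (L : unitAlgType R[i]) (kappa : {lrmorphism Q -> L})
        (s u1 u2 : L),
      cardano_extension kappa (iota d3) (iota f1) (iota j1) (iota Delta1)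
        s u1 u2 ->
      let inL (a : HI I h) : L := kappa (iota a) in
      let L0 := Lsub iota kappa s u1 u2 J0 in
      let root (nu : nat) : L := eps ^+ nu *: u1 + eps ^+ (2 * nu) *: u2 in
      let factor (nu : nat) : L := inL xi - root nu * inL eta in
      let X (nu : nat) : L := inL gamma - root nu * inL x1 in
      let Y (nu : nat) : L := inL delta - root nu * inL y1 in
      (exists C0 : Q,
        [/\ Qsub iota J0 C0, is_invariant uQ C0
          & inL f = kappa C0
              * (inL xi - (u1 + u2) * inL eta)
              * (inL xi - (eps *: u1 + eps ^+ 2 *: u2) * inL eta)
              * (inL xi - (eps ^+ 2 *: u1 + eps *: u2) * inL eta)])
      /\ forall nu : nat, nu \in [:: 1; 2; 3]%N ->
        [/\ factor nu
              = inL x * Y nu - inL y * X nu - h *: (inL y * Y nu),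
            forall uL : Uh_ops L, cardano_action h kappa uQ uL s u1 u2 ->
              nform uL L0 (inL x) (inL y) 1 (factor nu),
            Y nu != 0
          & projective_coordinate h L0 (inL x) (inL y) (factor nu)
              ((inL gamma - root nu * inL x1) / (inL delta - root nu * inL y1)
               + (h / 2)%:A)]].
Proof.
move=> x y x1 y1 J0 J01 JA JB JC JD fE [f0 fI _].
move=> [jI [S1 [S2 [S3 [PS1 PS2 PS3 jE]]]]].
(* The unknown coefficients of j thus avoid the indices 0 and 1 and are constants for the
   polarization. *)
have gen T : subalg_gen (fun a => [\/ a = A, a = B, a = C | a = D]) T ->
    Hsub J01 T.
  elim=> [a [->|->|->|->]|c|a b _ ? _ ?|a b _ ? _ ?] //.
  - exact: sg_cst.
  - exact: sg_add.
  - exact: sg_mul.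
move/gen: PS1 => JS1; move/gen: PS2 => JS2; move/gen: PS3 => JS3.
have lk : i1 != i0 by rewrite eq_sym.
have dom := HI_domain_of_quotient iotaP.
move=> P01 d3 f1 Delta1 j1 xi eta eps delta gamma.
have eps0 : eps ^+ 2 + eps + 1 = 0 := cbrt_unity R.
have eps3 : eps ^+ 3 = 1 := cube_root_unity eps0.
rewrite fE in f0 fI; rewrite jE in jI; move/eqP: f0 => f0.
have f1E : f1 = cubic x1 y1 A B C D.
  by rewrite /f1 fE; exact: (polar_f uHP lk D01P JA JB JC JD).
have j1E : j1 = x1 ^+ 3 * covS h A B C D + x1 ^+ 2 * y1 * S1
    + x1 * y1 ^+ 2 * S2 + y1 ^+ 3 * S3.
  by rewrite /j1 jE; exact: (polar_j uHP lk D01P JA JB JC JD JS1 JS2 JS3).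
have D1E : Delta1 = hessian h x1 y1 A B C D.
  exact: (polar_hessian uHP lk D01P JA JB JC JD).
have xiE : xi = x * delta - y * gamma - h *: (y * delta).
  by rewrite /xi fE; exact: (polar_xi uHP dom lk D01P JA JB JC JD fI).
rewrite fE f1E j1E D1E xiE; split.
- exact: (cardano_identity uHP dom lk D01P JA JB JC JD JS1 JS2 JS3 fI jI).
- split=> //; [exact: Hsub_gamma|exact: Hsub_delta|].
  by move=> g' d' Jg Jd; exact: (xi_unique uHP dom lk JA JB JC JD).
move=> L kappa s u1 u2 ext inL L0 root factor X Y; split.
  exact: (factorization uHP iotaP uQP lk D01P JA JB JC JD JS1 JS2 JS3 fI f0
    jI ext eps0).
move=> nu nu3.
(* The single-factor lemmas are applied with e = eps^nu, which for nu = 3 is the trivial root of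
   unity. *)
have e3 : (eps ^+ nu) ^+ 3 = 1 by rewrite exprAC eps3 expr1n.
have ee : eps ^+ (2 * nu) = (eps ^+ nu) ^+ 2 by rewrite mulnC exprM.
split.
- exact: (factor_linear i0 ext (eps ^+ nu) (eps ^+ (2 * nu))).
- move=> uL uLP.
  apply: (factor_form uHP iotaP uQP lk D01P JA JB JC JD fI ext uLP).
  exact: (factor_neq0 uHP iotaP uQP lk D01P JA JB JC JD JS1 JS2 JS3 fI f0
    jI ext eps0 nu3).
- exact: (denominator_neq0 uHP iotaP lk D01P JA JB JC JD JS1 JS2 JS3 fI f0
    jI ext e3 ee).
- exact: (factor_coordinate uHP iotaP lk D01P JA JB JC JD JS1 JS2 JS3 fI f0
    jI ext e3 ee).
Qed.
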